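(* Let $d\ge1$, $\mu\in{\mathcal P}(\mathbb{R}^d)$, $p\geq1$ and $\sigma>0$. Assume that $M_q(\mu)<\infty$ for some $q>p$. Then for every $\beta$ with $1<\beta<\frac{q+d}{p+d}$ there exists a constant $C_{\beta,\sigma}\in[0,\infty)$ depending only on $p,q,d,\sigma,\beta$ and $M_q(\mu)$ such that for all $N\ge1$, \[ \mathbb E\big[\big({\mathcal W}_p^{(\sigma)}(\mu_N,\mu)\big)^p\big] \ \leq \ \frac{C_{\beta,\sigma}}{N^{\min\left(\frac{\beta-1}{\beta},\frac{1}{2}\right)}}. \]
   Context: ${\mathcal P}(\mathbb R^d)$ is the set of Borel probability measures on $\mathbb R^d$, and $M_q(\mu)=\big(\int_{\mathbb R^d}|x|^q\,\mu(dx)\big)^{1/q}$. ${\mathcal W}_p(\mu,\nu)=\inf_{\pi\in\Pi(\mu,\nu)}\big(\int|x-y|^p\,\pi(dx,dy)\big)^{1/p}$ is the $p$-Wasserstein distance, $\Pi(\mu,\nu)$ being the set of couplings. ${\mathcal N}_\sigma$ denotes the centered Gaussian distribution on $\mathbb R^d$ with covariance $\sigma^2 I_d$, and ${\mathcal W}_p^{(\sigma)}(\mu,\nu)={\mathcal W}_p(\mu*{\mathcal N}_\sigma,\nu*{\mathcal N}_\sigma)$. Given $\mu$, $(X_k)_{k\ge1}$ is an i.i.d. sequence of $\mu$-distributed random variables and $\mu_N=\frac1N\sum_{k=1}^N\delta_{X_k}$ is the empirical measure. *)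

(* Defs.v *)
From HB Require Import structures.
From mathcomp Require Import all_boot all_order all_algebra.
From mathcomp Require Import all_classical all_reals all_analysis.
From mathcomp Require Import normal_distribution.
Set Implicit Arguments.
Unset Strict Implicit.
Unset Printing Implicit Defensive.
Import Order.TTheory GRing.Theory Num.Theory.
Import numFieldNormedType.Exports.
Local Open Scope classical_set_scope.
Local Open Scope ring_scope.

(* R^d is modelled as [d.-tuple R], equipped with
   the product (= Borel) sigma-algebra generated by the coordinate maps
   (library instance from measurable_structure.v). *)

Section Wasserstein.
Context {R : realType}.

Definition vadd d (x y : d.-tuple R) : d.-tuple R :=
  [tuple tnth x i + tnth y i | i < d].
Definition vsub d (x y : d.-tuple R) : d.-tuple R :=
  [tuple tnth x i - tnth y i | i < d].
Definition vnorm d (x : d.-tuple R) : R :=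
  Num.sqrt (\sum_(i < d) tnth x i ^+ 2).

(* Integral of f against the n-fold product measure mu^{(x) n} on n.-tuple T,
   computed as an iterated integral (Tonelli). *)
Fixpoint prod_int {dT} {T : measurableType dT} (mu : set T -> \bar R) (n : nat)
  : (n.-tuple T -> \bar R) -> \bar R :=
  match n with
  | 0 => fun f => f [tuple]
  | n'.+1 => fun f =>
      (\int[mu]_x prod_int mu (fun t : n'.-tuple T => f [tuple of x :: t]))%E
  end.

(* N_sigma : centered Gaussian on R^d with covariance sigma^2 I_d,
   i.e. the product of d copies of the 1-d normal law N(0, sigma^2). *)
Definition gaussian d (sigma : R) (A : set (d.-tuple R)) : \bar R :=
  prod_int (normal_prob 0 sigma) (fun y : d.-tuple R => (\1_A y)%:E).

Definition conv d (mu nu : set (d.-tuple R) -> \bar R) (A : set (d.-tuple R))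
  : \bar R :=
  (\int[mu]_x nu [set y | A (vadd x y)])%E.

Definition coupling d (mu nu : set (d.-tuple R) -> \bar R)
  (pi : probability (d.-tuple R * d.-tuple R)%type R) : Prop :=
  (forall A : set (d.-tuple R), measurable A -> pi (A `*` setT) = mu A) /\
  (forall B : set (d.-tuple R), measurable B -> pi (setT `*` B) = nu B).

Definition wasserstein d (p : R) (mu nu : set (d.-tuple R) -> \bar R) : \bar R :=
  ((ereal_inf [set (\int[pi]_z ((vnorm (vsub z.1 z.2)) `^ p)%:E)%E
               | pi in [set pi | coupling mu nu pi]]) `^ p^-1)%E.

Definition wasserstein_sigma d (p sigma : R) (mu nu : set (d.-tuple R) -> \bar R)
  : \bar R :=
  wasserstein p (conv mu (gaussian (d:=d) sigma)) (conv nu (gaussian (d:=d) sigma)).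

Definition moment d (q : R) (mu : set (d.-tuple R) -> \bar R) : \bar R :=
  ((\int[mu]_x ((vnorm x) `^ q)%:E) `^ q^-1)%E.

Definition empirical d (N : nat) (xs : nat -> d.-tuple R) (A : set (d.-tuple R))
  : \bar R :=
  ((N%:R^-1)%:E * \sum_(k < N) dirac (xs k) A)%E.

(* (X_k)_k is an i.i.d. sequence of mu-distributed random variables:
   each X_k has law mu, and the family is mutually independent
   (product rule for every finite subfamily, here every initial segment
   with arbitrary measurable sets, which includes all finite subfamilies
   by taking A i = setT). *)
Definition iid_seq {dO} {Omega : measurableType dO} (P : probability Omega R) d
  (X : nat -> {RV P >-> d.-tuple R}) (mu : set (d.-tuple R) -> \bar R) : Prop :=
  (forall k (A : set (d.-tuple R)), measurable A -> P (X k @^-1` A) = mu A) /\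
  (forall (n : nat) (A : nat -> set (d.-tuple R)), (forall i, measurable (A i)) ->
     P (\bigcap_(i in [set i | (i < n)%N]) (X i @^-1` A i)) =
     (\prod_(i < n) P (X i @^-1` A i))%E).

End Wasserstein.

(* Main.v *)
(** Reduce to [r = min beta 2], so that the rate is [(r - 1) / r].  The smoothed
    measures have densities [f_N] and [f] with respect to Lebesgue measure on
    R^d; keeping their common mass [min f_N f] in place and coupling the excess
    parts independently gives
      [W_p^p <= 2^p * \int (1 + |y|)^p * |f_N y - f y| dy].
    For fixed [y], [f_N y] is an empirical mean of the i.i.d. variables
    [g (X_k) = phi (y - X_k)].  Truncating [g] at level [N^(1/r) * tau] and using
    the variance for the bounded part and Markov's inequality for the tail gives,
    for every [tau > 0],
      [E |f_N y - f y| <= N^(1/r - 1) * (5/2 * tau^(1 - r) * E g(X)^r + tau / 2)].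
    Choosing [tau = (1 + |y|)^(-p) * \prod_i (1 + |y_i|)^(-a)] with
    [a = (q - p r) / (d (r - 1))], the second term integrates to a finite constant
    because [a > 1], and the first is at most a constant times
    [\int (1 + |y|)^q f y dy], finite by the moment assumption.  The
    condition [r < (q + d) / (p + d)] is exactly [a > 1]. *)
Require Import Defs.
From HB Require Import structures.
From mathcomp Require Import all_boot all_order all_algebra.
From mathcomp Require Import all_classical all_reals all_analysis.
From mathcomp Require Import measurable_realfun normal_distribution.
From mathcomp Require Import ring lra.
Set Implicit Arguments.
Unset Strict Implicit.
Unset Printing Implicit Defensive.
Import Order.TTheory GRing.Theory Num.Theory.
Import numFieldNormedType.Exports.
Import HBNNSimple.
Local Open Scope classical_set_scope.
Local Open Scope ring_scope.

(** The level [tau] is free at each [y], and the cost weight [(1 + |y|) ^ p] pulls it two ways: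
    [(1 + |y|) ^ p * tau] must be integrable over R^d, while [(1 + |y|) ^ p * tau ^ (1 - r)] may not
    outgrow [(1 + |y|) ^ q], the growth that the moment pays for. A product over coordinates is
    preferred to a power of the norm because Lebesgue measure on tuples is handled through iterated
    integrals: the integrals of the weights over R^d become [d]-th powers of integrals over the
    line, and the total decay [a * d > d] is that of an integrable radial weight. The estimates use
    two facts about the Gaussian, that its density is bounded and that it integrates
    [(1 + |t|) ^ q]. Neither involves the sample space or [mu], so the constant can be fixed before
    these are given. *)

(** * Integrals and densities *)

(* Unlike the library's [ge0_le_integral], no measurability is required: the
   integral of a nonnegative function is a supremum over simple functions.  The
   smoothed distance is not known to be a measurable function of the sample. *)
Lemma le_integral_pointwise d (T : measurableType d) (R : realType)
    (mu : {measure set T -> \bar R}) (f g : T -> \bar R) :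
  (forall x, 0 <= f x)%E -> (forall x, f x <= g x)%E ->
  (\int[mu]_x f x <= \int[mu]_x g x)%E.
Proof.
move=> f0 fg; have g0 x : (0 <= g x)%E by exact: le_trans (f0 x) (fg x).
rewrite (ge0_integralTE _ f0) (ge0_integralTE _ g0).
apply: ge_ereal_sup => _ [h hf <-]; apply: ereal_sup_ubound.
by exists h => // x; exact: le_trans (hf x) (fg x).
Qed.

Section density.
Context d (T : measurableType d) (R : realType).
Variables (m : {measure set T -> \bar R}) (f : T -> R).
Hypotheses (f0 : forall x, 0 <= f x) (mf : measurable_fun setT f).

(* The proofs [f0] and [mf] are arguments of [density] only so that its measure
   structure can be inferred. *)
Definition density (f0 : forall x, 0 <= f x) (mf : measurable_fun setT f)
  (A : set T) : \bar R := (\int[m]_(x in A) (f x)%:E)%E.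

Local Notation nu := (density f0 mf).

Let nu0 : nu set0 = 0%E. Proof. exact: integral_set0. Qed.

Let nu_ge0 A : (0 <= nu A)%E.
Proof. by apply: integral_ge0 => x _; rewrite lee_fin. Qed.

Let nu_sigma_additive : semi_sigma_additive nu.
Proof.
move=> F mF tF mUF; rewrite /density ge0_integral_bigcup//; last 2 first.
- exact/measurable_EFinP/measurable_funTS.
- by move=> x _; rewrite lee_fin.
apply: is_cvg_ereal_nneg_natsum_cond => n _ _.
by apply: integral_ge0 => x _; rewrite lee_fin.
Qed.

HB.instance Definition _ := isMeasure.Build _ _ _ nu nu0 nu_ge0 nu_sigma_additive.

Let integral_density_indic A : measurable A ->
  (\int[nu]_x (\1_A x)%:E = \int[m]_x ((\1_A x)%:E * (f x)%:E))%E.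
Proof.
move=> mA; rewrite integral_indic// setIT.
transitivity (nu A) => //; rewrite /density integral_mkcond.
apply: eq_integral => x _; rewrite patchE indicE.
by case: ifPn => _; rewrite ?mul1e ?mul0e.
Qed.

(** True for indicators by definition of the measure, for simple functions by linearity, and for [h]
    by monotone convergence along [nnsfun_approx] on both sides. *)
Lemma ge0_integral_density (h : T -> \bar R) : measurable_fun setT h ->
  (forall x, 0 <= h x)%E ->
  (\int[nu]_x h x = \int[m]_x (h x * (f x)%:E))%E.
Proof.
move=> mh h0; pose h_ := nnsfun_approx measurableT mh.
have mF : measurable_fun setT (EFin \o f) by exact/measurable_EFinP.
transitivity (limn (fun n => \int[nu]_x (h_ n x)%:E)%E).
  rewrite -monotone_convergence//.
  - apply: eq_integral => y _; apply/esym/cvg_lim => //.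
    by apply: cvg_nnsfun_approx=> // *.
  - by move=> n; exact/measurable_EFinP/measurable_funP.
  - by move=> n y _; rewrite lee_fin.
  - by move=> y _ a b ab; rewrite lee_fin; exact/lefP/nd_nnsfun_approx.
have -> : (fun n => \int[nu]_x (h_ n x)%:E)%E =
          (fun n => \int[m]_x ((h_ n x)%:E * (f x)%:E))%E.
  apply/funext => n.
  transitivity (\sum_(k \in range (h_ n))
     \int[nu]_x (k * \1_(h_ n @^-1` [set k]) x)%:E)%E.
    under eq_integral do rewrite fimfunE -fsumEFin//.
    rewrite ge0_integral_fsum//.
    - by move=> y; exact/measurable_EFinP/measurable_funM.
    - by move=> y x _; rewrite nnfun_muleindic_ge0.
  transitivity (\sum_(k \in range (h_ n))
     \int[m]_x ((k * \1_(h_ n @^-1` [set k]) x)%:E * (f x)%:E))%E; last first.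
    rewrite -ge0_integral_fsum//.
    - apply: eq_integral => x _; rewrite fimfunE -fsumEFin//.
      by rewrite ge0_mule_fsuml// => i; rewrite nnfun_muleindic_ge0.
    - by move=> y; apply: emeasurable_funM => //; exact/measurable_EFinP/measurable_funM.
    - by move=> y x _; rewrite mule_ge0 ?nnfun_muleindic_ge0 ?lee_fin.
  apply: eq_fsbigr => r _.
  rewrite integralZl_indic_nnsfun// integral_density_indic//.
  have [r0|r0] := leP 0 r.
    rewrite -ge0_integralZl//.
    - by apply: eq_integral => x _; rewrite EFinM muleA.
    - by apply: emeasurable_funM => //; exact/measurable_EFinP/measurable_indic.
    - by move=> x _; rewrite mule_ge0// lee_fin.
  (* A negative [r] is not a value of the nonnegative function [h_ n], so its level set is empty and
     both sides are zero. *)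
  rewrite preimage_nnfun0// indic0.
  under eq_integral do rewrite /= mul0e.
  under [in RHS]eq_integral do rewrite /= mulr0 mul0e.
  by rewrite integral0 mule0.
rewrite -monotone_convergence//.
- apply: eq_integral => y _; apply/cvg_lim => //.
  apply: cvgeZr => //.
  exact: cvg_nnsfun_approx.
- by move=> n; apply: emeasurable_funM => //; exact/measurable_EFinP/measurable_funP.
- by move=> n y _; rewrite mule_ge0 ?lee_fin.
- move=> y _ a b ab; rewrite lee_wpmul2r ?lee_fin//.
  exact/lefP/nd_nnsfun_approx.
Qed.

End density.

(** * Product measures on tuples *)

(** A pushforward comes with the structure of a measure only. Once shown sigma-finite, it is
    repackaged here in the form that Tonelli's theorem requires. *)
Lemma sigma_finite_measureP d (T : measurableType d) (R : realType)
    (M : {measure set T -> \bar R}) : sigma_finite setT M ->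
  exists M' : {sigma_finite_measure set T -> \bar R},
    M' = M :> (set T -> \bar R).
Proof.
move=> sM.
pose H2 := isSFinite.Build _ _ _ _ (sfinite_measure_sigma_finite sM).
pose H3 := isSigmaFinite.Build _ _ _ _ sM.
pose M' := HB.pack_for (SigmaFiniteMeasure.type T R) (Measure.sort M) H2 H3.
by exists M'.
Qed.

Section prod_int.
Local Open Scope ereal_scope.
Context {d} {T : measurableType d} {R : realType}.
Implicit Types m : {sigma_finite_measure set T -> \bar R}.

Lemma prod_int_ge0 (m : {measure set T -> \bar R}) n (f : n.-tuple T -> \bar R) :
  (forall t, 0 <= f t) -> 0 <= prod_int m f.
Proof.
elim: n f => [|n IH] f f0 /=; first exact: f0.
by apply: integral_ge0 => x _; apply: IH.
Qed.

Lemma measurable_tcons n :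
  measurable_fun setT (fun z : T * n.-tuple T => [tuple of z.1 :: z.2]).
Proof. by apply: measurable_cons. Qed.

Lemma measurable_tcons2 d' (T' : measurableType d') n (x : T)
    (f : n.+1.-tuple T -> T') :
  measurable_fun setT f ->
  measurable_fun setT (fun t : n.-tuple T => f [tuple of x :: t]).
Proof.
move=> mf; apply: (measurableT_comp mf).
by apply: measurable_cons.
Qed.

(* [prod_int m] is only a functional; Tonelli's theorem needs the measure. *)
Lemma tuple_measure m n : exists L : {sigma_finite_measure set (n.-tuple T) -> \bar R},
  forall f : n.-tuple T -> \bar R, measurable_fun setT f -> (forall t, 0 <= f t) ->
  \int[L]_t f t = prod_int m f.
Proof.
elim: n => [|n [L HL]].
  exists \d_([tuple] : 0.-tuple T) => f mf f0.
  by rewrite integral_dirac// diracT mul1e.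
pose c := fun z : T * n.-tuple T => [tuple of z.1 :: z.2].
have mc : measurable_fun setT c by exact: measurable_tcons.
pose uc := fun t : n.+1.-tuple T => (thead t, [tuple of behead t] : n.-tuple T).
have muc : measurable_fun setT uc.
  apply: measurable_fun_pair; last exact: measurable_behead.
  exact: measurable_tnth.
have ucK z : uc (c z) = z.
  by case: z => x t; congr pair; apply/val_inj.
pose M0 : {measure set (n.+1.-tuple T) -> \bar R} := pushforward (m \x L) c.
pose M := M0 mc.
(* Rectangles exhausting [T * n.-tuple T], pulled back along [uc], exhaust the tuples; they keep
   their measure because [uc \o c = id]. *)
have sM : sigma_finite setT M.
  have /sigma_finiteP[F [FT ndF Foo]] := sigma_finiteT m.
  have /sigma_finiteP[G [GT ndG Goo]] := sigma_finiteT L.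
  exists (fun k => uc @^-1` (F k `*` G k)).
    apply/seteqP; split => // t _.
    have [i _ Fi] : (\bigcup_i F i) (uc t).1 by rewrite -FT.
    have [j _ Gj] : (\bigcup_i G i) (uc t).2 by rewrite -GT.
    exists (maxn i j) => //; split.
    - by move: Fi; exact/subsetPset/ndF/leq_maxl.
    - by move: Gj; exact/subsetPset/ndG/leq_maxr.
  move=> k; have [mF Fk] := Foo k; have [mG Gk] := Goo k; split.
    by rewrite -[X in measurable X]setTI; apply: muc => //; exact: measurableX.
  suff -> : M (uc @^-1` (F k `*` G k)) = (m \x L) (F k `*` G k).
    by rewrite product_measure1E// lte_mul_pinfty// ge0_fin_numE.
  rewrite /M/= /M0/= /pushforward -comp_preimage.
  have -> : uc \o c = id by apply/funext => z; exact: ucK.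
  by rewrite preimage_id.
have [M' M'E] := sigma_finite_measureP sM.
exists M' => f mf f0.
transitivity (\int[M]_t f t); first by rewrite M'E.
rewrite ge0_integral_pushforward//= fubini_tonelli1//; last first.
  by apply: (measurableT_comp mf).
apply: eq_integral => x _; rewrite /fubini_F/= -HL//.
exact: measurable_tcons2.
Qed.

Lemma measurable_prod_int m n (f : n.+1.-tuple T -> \bar R) :
  measurable_fun setT f -> (forall t, 0 <= f t) ->
  measurable_fun setT (fun x => prod_int m (fun t : n.-tuple T => f [tuple of x :: t])).
Proof.
move=> mf f0; have [L HL] := tuple_measure m n.
rewrite [X in measurable_fun _ X](_ : _ =
    fubini_F L (fun z => f [tuple of z.1 :: z.2])); last first.
  by apply/funext => x; rewrite /fubini_F -HL//; exact: measurable_tcons2.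
apply: measurable_fun_fubini_tonelli_F => //.
by apply: (measurableT_comp mf); exact: measurable_tcons.
Qed.

Lemma prod_intZl m n (k : R) (f : n.-tuple T -> \bar R) :
  measurable_fun setT f -> (forall t, 0 <= f t) -> (0 <= k)%R ->
  prod_int m (fun t => k%:E * f t) = k%:E * prod_int m f.
Proof.
move=> mf f0 k0; have [L HL] := tuple_measure m n.
rewrite -!HL//.
- by rewrite ge0_integralZl.
- exact: emeasurable_funM.
- by move=> t; rewrite mule_ge0.
Qed.

End prod_int.

(** * Iterated Lebesgue and Gaussian integrals on R^d *)

Section lebesgue_tuple.
Local Open Scope ereal_scope.
Context {R : realType}.
Local Notation RM := (measurableTypeR R).
Local Notation leb := (@lebesgue_measure R : {sigma_finite_measure set RM -> \bar R}).
Local Notation lint := (@prod_int R _ RM leb).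

Lemma measurable_tuple_sum n (h : R -> R -> R) (x : n.-tuple R) :
  (forall a, measurable_fun setT (h a : RM -> RM)) ->
  measurable_fun setT (fun y : n.-tuple RM =>
    [tuple h (tnth x i) (tnth y i) | i < n] : n.-tuple RM).
Proof.
move=> mh; apply/measurable_fun_tnthP => i.
rewrite (_ : _ \o _ = h (tnth x i) \o (@tnth n RM ^~ i)).
  by apply: (measurableT_comp (mh _)); exact: measurable_tnth.
by apply/funext => y /=; rewrite tnth_mktuple.
Qed.

Lemma measurable_vadd n (x : n.-tuple RM) :
  measurable_fun setT (fun y : n.-tuple RM => vadd x y : n.-tuple RM).
Proof.
by apply: (@measurable_tuple_sum n (fun a b => a + b)%R) => a; exact: measurable_funD.
Qed.

(** The pushforward of [leb] under [a + _] gives each interval []b, c]] its length, and this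
    determines Lebesgue measure. *)
Lemma ge0_integral_shift (a : R) (f : RM -> \bar R) :
  measurable_fun setT f -> (forall t, 0 <= f t) ->
  \int[leb]_t f (a + t)%R = \int[leb]_t f t.
Proof.
move=> mf f0.
have ma : measurable_fun setT ((fun t => (a + t)%R) : RM -> RM).
  exact: measurable_funD.
transitivity (\int[pushforward leb (fun t : RM => (a + t)%R : RM)]_t f t).
  by rewrite ge0_integral_pushforward.
apply: eq_measure_integral => A mA _; apply/esym.
apply: (@lebesgue_measure_unique R (pushforward leb (fun t : RM => (a + t)%R : RM))) => //.
move=> _ [[b c]] _ <-; rewrite /=.
have E : (fun t : RM => (a + t)%R : RM) @^-1` [set` `]b, c]] =
          [set` `](b - a)%R, (c - a)%R]].
  by apply/seteqP; split => t /=; rewrite !in_itv/= ltrBlDl lerBrDl.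
transitivity (@lebesgue_measure R ((fun t : RM => (a + t)%R : RM) @^-1` [set` `]b, c]])) => //.
rewrite E !lebesgue_measure_itv.
rewrite /= !lte_fin ltrD2r.
by case: ifP => // _; rewrite -!EFinD; congr EFin; rewrite opprB addrA subrK.
Qed.

Lemma vadd_tcons n (x y : R) (s t : n.-tuple R) :
  vadd [tuple of x :: s] [tuple of y :: t] = [tuple of (x + y)%R :: vadd s t].
Proof.
apply: eq_from_tnth => i; rewrite tnth_mktuple.
case: (unliftP ord0 i) => [j ->|->]; last by rewrite !tnth0.
by rewrite !tnthS tnth_mktuple.
Qed.

(** Translation invariance one coordinate at a time. It turns the law of a shifted Gaussian into a
    density in the target point. *)
Lemma prod_int_shift n (x : n.-tuple R) (f : n.-tuple RM -> \bar R) :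
  measurable_fun setT f -> (forall t, 0 <= f t) ->
  lint (fun t : n.-tuple R => f (vadd x t)) = lint f.
Proof.
elim: n x f => [|n IH] x f mf f0 /=; first by rewrite (tuple0 (vadd _ _)).
case/tupleP: x => x s.
transitivity (\int[leb]_u lint (fun t : n.-tuple R => f [tuple of (x + u)%R :: t])).
  apply: eq_integral => u _.
  rewrite -(IH s (fun t : n.-tuple R => f [tuple of (x + u)%R :: t]))//.
    by congr (lint _); apply/funext => t; rewrite vadd_tcons.
  exact: measurable_tcons2.
apply: (@ge0_integral_shift x (fun u => lint (fun t : n.-tuple R => f [tuple of u :: t]))).
- exact: measurable_prod_int.
- by move=> u; exact: prod_int_ge0.
Qed.

Definition tprod n (h : R -> R) (t : n.-tuple R) : R := (\prod_(i < n) h (tnth t i))%R.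

Lemma tprod_ge0 n (h : R -> R) (t : n.-tuple R) :
  (forall x, 0 <= h x)%R -> (0 <= tprod h t)%R.
Proof. by move=> h0; apply: prodr_ge0. Qed.

Lemma tprod_cons n h x (t : n.-tuple R) :
  tprod h [tuple of x :: t] = (h x * tprod h t)%R.
Proof.
rewrite /tprod big_ord_recl tnth0; congr (_ * _)%R.
by apply: eq_bigr => i _; rewrite tnthS.
Qed.

Lemma measurable_tprod n (h : R -> R) : measurable_fun setT (h : RM -> RM) ->
  measurable_fun setT (@tprod n h : n.-tuple RM -> RM).
Proof.
move=> mh; apply: measurable_prod => i _.
by apply: (measurableT_comp mh); exact: measurable_tnth.
Qed.

Lemma prod_int_tprod n (h : R -> R) : measurable_fun setT (h : RM -> RM) ->
  (forall x, 0 <= h x)%R ->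
  lint (fun t : n.-tuple R => (tprod h t)%:E) = (\int[leb]_x (h x)%:E) ^+ n.
Proof.
move=> mh h0; elim: n => [|n IH]; first by rewrite /= /tprod big_ord0.
transitivity (\int[leb]_x ((h x)%:E * (\int[leb]_x (h x)%:E) ^+ n)).
  rewrite /=; apply: eq_integral => x _; rewrite -IH -prod_intZl//.
  - by congr (lint _); apply/funext => t; rewrite tprod_cons EFinM.
  - by apply/measurable_EFinP; exact: measurable_tprod.
  - by move=> t; rewrite lee_fin tprod_ge0.
rewrite expeS ge0_integralZr//.
- exact/measurable_EFinP.
- by move=> x _; rewrite lee_fin.
- by apply: expe_ge0; apply: integral_ge0 => x _; rewrite lee_fin.
Qed.

Lemma ge0_integral_normal_prob (s : R) (f : RM -> \bar R) :
  measurable_fun setT f -> (forall t, 0 <= f t) ->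
  \int[normal_prob 0 s]_t f t = \int[leb]_t ((normal_pdf 0 s t)%:E * f t).
Proof.
move=> mf f0.
have p0 := normal_pdf_ge0 0%R s; have mp := measurable_normal_pdf 0%R s.
transitivity (\int[density leb p0 mp]_t f t) => //.
rewrite ge0_integral_density//.
by apply: eq_integral => t _; rewrite muleC.
Qed.

Lemma prod_int_normal n (s : R) (f : n.-tuple RM -> \bar R) :
  measurable_fun setT f -> (forall t, 0 <= f t) ->
  prod_int (normal_prob 0 s) f = lint (fun t => (tprod (normal_pdf 0 s) t)%:E * f t).
Proof.
have p0 := normal_pdf_ge0 0%R s; have mp := measurable_normal_pdf 0%R s.
elim: n f => [|n IH] f mf f0 /=; first by rewrite /tprod big_ord0 mul1e.
have mpf (x : R) : measurable_fun setT (fun t : n.-tuple RM =>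
    (tprod (normal_pdf 0 s) t)%:E * f [tuple of x :: t]).
  apply: emeasurable_funM; last exact: measurable_tcons2.
  by apply/measurable_EFinP; exact: measurable_tprod.
transitivity (\int[normal_prob 0 s]_x lint (fun t : n.-tuple R =>
    (tprod (normal_pdf 0 s) t)%:E * f [tuple of x :: t])).
  by apply: eq_integral => x _; rewrite IH//; exact: measurable_tcons2.
rewrite ge0_integral_normal_prob//.
- apply: eq_integral => x _; rewrite -prod_intZl//.
  + by congr (lint _); apply/funext => t; rewrite tprod_cons EFinM muleA.
  + by move=> t; rewrite mule_ge0// lee_fin tprod_ge0.
(* The Gaussian factor of [F] reads only the tail of [u], which puts the inner integral in the form
   required by [measurable_prod_int]. *)
- pose F (u : n.+1.-tuple RM) :=
    (tprod (normal_pdf 0 s) ([tuple of behead u] : n.-tuple R))%:E * f u.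
  have FE (x : R) (t : n.-tuple R) : F [tuple of x :: t] =
      (tprod (normal_pdf 0 s) t)%:E * f [tuple of x :: t].
    by rewrite /F; congr ((tprod _ _)%:E * _); apply/val_inj.
  have mF : measurable_fun setT F.
    apply: emeasurable_funM => //; apply/measurable_EFinP.
    have mb : measurable_fun setT
        (fun u : n.+1.-tuple RM => [tuple of behead u] : n.-tuple RM).
      exact: measurable_behead.
    exact: (measurableT_comp (measurable_tprod mp) mb).
  have F0 t : 0 <= F t by rewrite mule_ge0// lee_fin tprod_ge0.
  have := measurable_prod_int leb mF F0; congr measurable_fun.
  by apply/funext => x; congr (lint _); apply/funext => t.
- move=> x; apply: prod_int_ge0 => t.
  by rewrite mule_ge0// lee_fin tprod_ge0.
Qed.

End lebesgue_tuple.

(** * Coupling two densities *)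

(** Normalising a measure of mass one divides by one, and the result carries the probability
    structure. *)
Lemma probability_of_measure d (T : measurableType d) (R : realType)
    (M : {measure set T -> \bar R}) : M setT = 1%E ->
  exists P : probability T R, P = M :> (set T -> \bar R).
Proof.
move=> M1; exists (mnormalize M (\d_point : probability T R)).
apply/funext => U; rewrite /= /mnormalize M1 onee_eq0/= invr1.
by rewrite mule1.
Qed.

Lemma indicX (T1 T2 : Type) (R : pzRingType) (A : set T1) (B : set T2) x y :
  \1_(A `*` B) (x, y) = \1_A x * \1_B y :> R.
Proof. by rewrite !indicE in_setX -natrM mulnb. Qed.

Section coupling.
Local Open Scope ereal_scope.
Context d (T : measurableType d) (R : realType).
Variable lam : {sigma_finite_measure set T -> \bar R}.
Variables (f g V : T -> R) (c : T * T -> R).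
Hypotheses (f0 : forall x, (0 <= f x)%R) (g0 : forall x, (0 <= g x)%R).
Hypotheses (mf : measurable_fun setT f) (mg : measurable_fun setT g).
Hypotheses (f1 : \int[lam]_x (f x)%:E = 1) (g1 : \int[lam]_x (g x)%:E = 1).
Hypotheses (V0 : forall x, (0 <= V x)%R) (mV : measurable_fun setT V).
Hypotheses (c0 : forall z, (0 <= c z)%R) (mc : measurable_fun setT c).
Hypotheses (cxx : forall x, c (x, x) = 0%R).
Hypotheses (cV : forall x y, (c (x, y) <= V x + V y)%R).

(** With these, [f = h + a] and [g = h + b], while [a + b = |f - g|] produces the right side of the
    final bound. *)
Let a x := Num.max (f x - g x)%R 0%R.
Let b x := Num.max (g x - f x)%R 0%R.
Let h x := Num.min (f x) (g x).

Let a0 x : (0 <= a x)%R. Proof. by rewrite le_max lexx orbT. Qed.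
Let b0 x : (0 <= b x)%R. Proof. by rewrite le_max lexx orbT. Qed.
Let h0 x : (0 <= h x)%R. Proof. by rewrite le_min f0 g0. Qed.

Let ma : measurable_fun setT a.
Proof. by apply: measurable_maxr => //; exact: measurable_funB. Qed.
Let mb : measurable_fun setT b.
Proof. by apply: measurable_maxr => //; exact: measurable_funB. Qed.
Let mh : measurable_fun setT h. Proof. exact: measurable_minr. Qed.

Let fE x : f x = (h x + a x)%R.
Proof.
rewrite /h /a; case: (leP (f x) (g x)) => fg.
  by rewrite max_r ?addr0// subr_le0.
by rewrite max_l ?subr_ge0 ?(ltW fg)// addrC subrK.
Qed.

Let gE x : g x = (h x + b x)%R.
Proof.
rewrite /h /b; case: (leP (f x) (g x)) => fg.
  by rewrite max_l ?subr_ge0// addrC subrK.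
by rewrite max_r ?addr0// subr_le0 ltW.
Qed.

Let abE x : (a x + b x)%R = `|f x - g x|%R.
Proof.
rewrite /a /b; case: (leP (f x) (g x)) => fg.
  by rewrite max_r ?subr_le0// max_l ?subr_ge0// add0r ler0_norm ?subr_le0// opprB.
by rewrite max_l ?subr_ge0 ?(ltW fg)// max_r ?subr_le0 ?(ltW fg)// addr0 ger0_norm// subr_ge0 ltW.
Qed.

Let eaM A : measurable A -> \int[lam]_(x in A) (f x)%:E =
  \int[lam]_(x in A) (h x)%:E + \int[lam]_(x in A) (a x)%:E.
Proof.
move=> mA; rewrite -ge0_integralD//.
- by apply: eq_integral => x _; rewrite fE EFinD.
- by move=> x _; rewrite lee_fin.
- exact/measurable_EFinP/measurable_funTS.
- by move=> x _; rewrite lee_fin.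
- exact/measurable_EFinP/measurable_funTS.
Qed.

Let ebM A : measurable A -> \int[lam]_(x in A) (g x)%:E =
  \int[lam]_(x in A) (h x)%:E + \int[lam]_(x in A) (b x)%:E.
Proof.
move=> mA; rewrite -ge0_integralD//.
- by apply: eq_integral => x _; rewrite gE EFinD.
- by move=> x _; rewrite lee_fin.
- exact/measurable_EFinP/measurable_funTS.
- by move=> x _; rewrite lee_fin.
- exact/measurable_EFinP/measurable_funTS.
Qed.

Let Ia := \int[lam]_x (a x)%:E.

Let ih_fin : \int[lam]_x (h x)%:E \is a fin_num.
Proof.
rewrite ge0_fin_numE ?integral_ge0// => [|x _]; last by rewrite lee_fin.
apply: (@le_lt_trans _ _ 1); last exact: ltry.
rewrite -f1; apply: le_integral_pointwise => x; rewrite lee_fin//.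
by rewrite ge_min lexx.
Qed.

(** Both densities have mass one and share the part [h], whose finite mass can be cancelled. *)
Let IaE : \int[lam]_x (b x)%:E = Ia.
Proof.
rewrite -[LHS](addeK _ ih_fin) -[RHS](addeK _ ih_fin).
by rewrite ![_ + \int[lam]_x (h x)%:E]addeC -ebM// -eaM// f1 g1.
Qed.

Let Ia_fin : Ia \is a fin_num.
Proof.
rewrite ge0_fin_numE ?integral_ge0// => [|x _]; last by rewrite lee_fin.
apply: (@le_lt_trans _ _ 1); last exact: ltry.
rewrite -f1; apply: le_integral_pointwise => x; rewrite lee_fin// fE.
by rewrite lerDr.
Qed.

Let m := fine Ia.
Let m0 : (0 <= m)%R.
Proof. by rewrite fine_ge0// integral_ge0// => x _; rewrite lee_fin. Qed.
Let mE : Ia = m%:E. Proof. by rewrite fineK. Qed.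

(** The product of the two excesses has mass [m ^+ 2]; divided by [m], it has marginal densities [a]
    and [b]. *)
Let k z := (a z.1 * b z.2 * m^-1)%R.
Let k0 z : (0 <= k z)%R.
Proof. by rewrite !mulr_ge0// invr_ge0. Qed.
Let mk : measurable_fun setT k.
Proof.
apply: measurable_funM => //; apply: measurable_funM.
  exact: (measurableT_comp ma).
exact: (measurableT_comp mb).
Qed.

Let diag (x : T) := (x, x).
Let mdiag : measurable_fun setT diag.
Proof. exact: measurable_fun_pair. Qed.

(** The image of the density [h] under the diagonal, plus the density [k] on the product. The
    formula is given for integrals of functions because both the marginals and the cost are read off
    from it. *)
Let coupling_measure : exists M : {measure set (T * T)%type -> \bar R},
  forall F : T * T -> \bar R, measurable_fun setT F -> (forall z, 0 <= F z) ->
  \int[M]_z F z = \int[lam]_x (F (x, x) * (h x)%:E) +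
     \int[lam]_x \int[lam]_y (F (x, y) * (k (x, y))%:E).
Proof.
pose D0 : {measure set (T * T)%type -> \bar R} := pushforward (density lam h0 mh) diag.
pose K : {measure set (T * T)%type -> \bar R} := density (lam \x lam) k0 mk.
exists (measure_add (D0 mdiag) K) => F mF F0.
rewrite ge0_integral_measure_add//; congr (_ + _).
  rewrite ge0_integral_pushforward//= ge0_integral_density//=.
  exact: (measurableT_comp mF).
rewrite ge0_integral_density// fubini_tonelli1//.
  by apply: emeasurable_funM => //; exact/measurable_EFinP.
by move=> z; rewrite mule_ge0// lee_fin.
Qed.

Let integral_b (A : set T) x : measurable A ->
  \int[lam]_(y in A) ((k (x, y))%:E) = (a x / m)%:E * \int[lam]_(y in A) (b y)%:E.
Proof.
move=> mA; rewrite -ge0_integralZl//.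
- by apply: eq_integral => y _; rewrite -EFinM /k/= mulrAC.
- exact/measurable_EFinP/measurable_funTS.
- by move=> y _; rewrite lee_fin.
- by rewrite lee_fin divr_ge0.
Qed.

Let integral_a (A : set T) y : measurable A ->
  \int[lam]_(x in A) ((k (x, y))%:E) = (b y / m)%:E * \int[lam]_(x in A) (a x)%:E.
Proof.
move=> mA; rewrite -ge0_integralZl//.
- by apply: eq_integral => x _; rewrite -EFinM /k/= [in RHS]mulrC mulrA.
- exact/measurable_EFinP/measurable_funTS.
- by move=> x _; rewrite lee_fin.
- by rewrite lee_fin divr_ge0.
Qed.

(* [m^-1 = 0] when [m = 0], in which case [a] and [b] vanish a.e. *)
Let cancel_m (u : T -> R) (W : T -> R) : (forall x, 0 <= u x)%R ->
  (forall x, 0 <= W x)%R -> measurable_fun setT u -> measurable_fun setT W ->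
  \int[lam]_x (u x)%:E = m%:E ->
  \int[lam]_x ((W x)%:E * ((u x / m)%:E * m%:E)) = \int[lam]_x ((W x)%:E * (u x)%:E).
Proof.
move=> u0 W0 mu mW; have [m0E|mN0] := eqVneq m 0%R; last first.
  by move=> _; apply: eq_integral => x _; rewrite -EFinM divfK.
rewrite m0E => u_int; under eq_integral do rewrite mule0 mule0.
rewrite integral0; apply/esym.
have mEu : measurable_fun setT (EFin \o u) by exact/measurable_EFinP.
have : ae_eq lam setT (EFin \o u) (cst 0).
  apply/ae_eq_integral_abs => //.
  by under eq_integral do rewrite /= ger0_norm//.
move=> uae; rewrite -(integral0 lam setT); apply: ae_eq_integral => //.
- apply: emeasurable_funM => //; exact/measurable_EFinP.
- apply: filterS uae => x /(_ I) /= -> _.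
  by rewrite mule0.
Qed.

(** The diagonal part costs nothing by [cxx]. On the rest, [c (x, y)] is split as [V x + V y], and
    integrating out the other variable leaves [V * a] and [V * b]. *)
Lemma coupling_densities : exists P : probability (T * T)%type R,
  [/\ forall A, measurable A -> P (A `*` setT) = \int[lam]_(x in A) (f x)%:E,
      forall B, measurable B -> P (setT `*` B) = \int[lam]_(x in B) (g x)%:E &
      \int[P]_z (c z)%:E <= \int[lam]_x (V x * `|f x - g x|)%:E].
Proof.
have [M MF] := coupling_measure.
have IbE : \int[lam]_x (b x)%:E = m%:E by rewrite IaE mE.
have mindic (A : set T) : measurable A -> measurable_fun setT (\1_A : T -> R).
  by move=> mA; exact: measurable_indic.
have ind (A : set T) (u : T -> R) : \int[lam]_(x in A) (u x)%:E =
    \int[lam]_x ((\1_A x)%:E * (u x)%:E).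
  rewrite integral_mkcond; apply: eq_integral => x _; rewrite patchE indicE.
  by case: ifPn => _; rewrite ?mul1e ?mul0e.
have mk1 x : measurable_fun setT (fun y => (k (x, y))%:E).
  by apply/measurable_EFinP; apply: (measurableT_comp mk).
have mk2 y : measurable_fun setT (fun x => (k (x, y))%:E).
  by apply/measurable_EFinP; apply: (measurableT_comp mk).
have M1 A : measurable A -> M (A `*` setT) = \int[lam]_(x in A) (f x)%:E.
  move=> mA; have mAT : measurable (A `*` [set: T]) by exact: measurableX.
  transitivity (\int[M]_z (\1_(A `*` setT) z)%:E).
    by rewrite integral_indic// setIT.
  rewrite MF//; last 1 first.
  - exact/measurable_EFinP/measurable_indic.
  rewrite eaM// (ind A h) (ind A a); congr (_ + _).
    by apply: eq_integral => x _; rewrite indicX indicT mulr1.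
  rewrite -(cancel_m a0 _ ma (mindic A mA) mE)//.
  apply: eq_integral => x _; rewrite -[in RHS]IbE -integral_b// -ge0_integralZl//.
    by apply: eq_integral => y _; rewrite indicX indicT mulr1.
  by move=> y _; rewrite lee_fin.
have M2 B : measurable B -> M (setT `*` B) = \int[lam]_(x in B) (g x)%:E.
  move=> mB; have mTB : measurable ([set: T] `*` B) by exact: measurableX.
  transitivity (\int[M]_z (\1_(setT `*` B) z)%:E).
    by rewrite integral_indic// setIT.
  rewrite MF//; last 1 first.
  - exact/measurable_EFinP/measurable_indic.
  rewrite ebM// (ind B h) (ind B b); congr (_ + _).
    by apply: eq_integral => x _; rewrite indicX indicT mul1r.
  rewrite (@fubini_tonelli _ _ _ _ _ lam lam
    (fun z => (\1_(setT `*` B) z)%:E * (k z)%:E)); last 2 first.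
  - apply: emeasurable_funM; last exact/measurable_EFinP.
    exact/measurable_EFinP/measurable_indic.
  - by move=> z; rewrite mule_ge0// lee_fin.
  rewrite -(cancel_m b0 _ mb (mindic B mB) IbE)//.
  apply: eq_integral => y _; rewrite -[in RHS]mE -integral_a// -ge0_integralZl//.
    by apply: eq_integral => x _; rewrite indicX indicT mul1r.
  by move=> x _; rewrite lee_fin.
have [P PM] : exists P : probability (T * T)%type R, P = M :> (set _ -> \bar R).
  by apply: probability_of_measure; rewrite -setXTT M1.
exists P; rewrite PM; split => //.
have mEc : measurable_fun setT (EFin \o c) by exact/measurable_EFinP.
rewrite (MF (EFin \o c))//=.
rewrite integral0_eq ?add0e; last by move=> x _; rewrite cxx mul0e.
have mEk : measurable_fun setT (EFin \o k) by exact/measurable_EFinP.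
have mEV : measurable_fun setT (EFin \o V) by exact/measurable_EFinP.
apply: (@le_trans _ _ (\int[lam]_x \int[lam]_y
    ((V x)%:E * (k (x, y))%:E + (V y)%:E * (k (x, y))%:E))).
  apply: le_integral_pointwise => [x|x].
    by apply: integral_ge0 => y _; rewrite mule_ge0// lee_fin.
  apply: le_integral_pointwise => y; first by rewrite mule_ge0// lee_fin.
  by rewrite -!EFinM -EFinD lee_fin -mulrDl ler_wpM2r.
have Vk0 x z : 0 <= (V x)%:E * (k z)%:E by rewrite mule_ge0// lee_fin.
have mF1 : measurable_fun setT (fun z => (V z.1)%:E * (k z)%:E).
  by apply: emeasurable_funM => //; exact: (measurableT_comp mEV).
have mF2 : measurable_fun setT (fun z => (V z.2)%:E * (k z)%:E).
  by apply: emeasurable_funM => //; exact: (measurableT_comp mEV).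
have -> : \int[lam]_x \int[lam]_y
    ((V x)%:E * (k (x, y))%:E + (V y)%:E * (k (x, y))%:E) =
  \int[lam]_x (\int[lam]_y ((V x)%:E * (k (x, y))%:E) +
               \int[lam]_y ((V y)%:E * (k (x, y))%:E)).
  apply: eq_integral => x _; rewrite ge0_integralD//.
  - exact: emeasurable_funM.
  - exact: emeasurable_funM.
rewrite ge0_integralD//; last 4 first.
- by move=> x _; apply: integral_ge0.
- exact: (measurable_fun_fubini_tonelli_F _ mF1).
- by move=> x _; apply: integral_ge0.
- exact: (measurable_fun_fubini_tonelli_F _ mF2).
have -> : \int[lam]_x \int[lam]_y ((V x)%:E * (k (x, y))%:E) =
  \int[lam]_x ((V x)%:E * (a x)%:E).
  rewrite -(cancel_m a0 V0 ma mV mE); apply: eq_integral => x _.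
  rewrite -[in RHS]IbE -integral_b// -ge0_integralZl ?lee_fin//.
  by move=> y _; rewrite lee_fin.
rewrite (@fubini_tonelli _ _ _ _ _ lam lam (fun z => (V z.2)%:E * (k z)%:E))//.
have -> : \int[lam]_y \int[lam]_x ((V y)%:E * (k (x, y))%:E) =
  \int[lam]_x ((V x)%:E * (b x)%:E).
  rewrite -(cancel_m b0 V0 mb mV IbE); apply: eq_integral => x _.
  rewrite -[in RHS]mE -integral_a// -ge0_integralZl ?lee_fin//.
  by move=> y _; rewrite lee_fin.
rewrite -ge0_integralD//.
- rewrite le_eqVlt; apply/orP; left; apply/eqP; apply: eq_integral => x _.
  by rewrite -!EFinM -EFinD -mulrDr abE.
- by move=> x _; rewrite mule_ge0// lee_fin.
- by apply: emeasurable_funM => //; exact/measurable_EFinP.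
- by move=> x _; rewrite mule_ge0// lee_fin.
- by apply: emeasurable_funM => //; exact/measurable_EFinP.
Qed.

End coupling.

(** * Empirical means of i.i.d. variables *)

Lemma integral_probability_cst d (T : measurableType d) (R : realType)
  (P : probability T R) (k : \bar R) : (\int[P]_x k = k)%E.
Proof.
rewrite (integral_cst P measurableT) -[RHS]mule1; congr (_ * _)%E.
exact: probability_setT.
Qed.

Section iid.
Local Open Scope ereal_scope.
Context dO (Omega : measurableType dO) d (T : measurableType d) (R : realType).
Variables (P : probability Omega R) (mu : probability T R).
Variable X : nat -> {RV P >-> T}.
Hypothesis law : forall k A, measurable A -> P (X k @^-1` A) = mu A.
Hypothesis pairwise_indep : forall i j A B, i != j -> measurable A ->
  measurable B -> P (X i @^-1` A `&` X j @^-1` B) = mu A * mu B.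

Lemma integral_law k (u : T -> \bar R) : measurable_fun setT u ->
  (forall x, 0 <= u x) -> \int[P]_w u (X k w) = \int[mu]_x u x.
Proof.
move=> mfu u0.
transitivity (\int[distribution P (X k)]_x u x).
  by rewrite ge0_integral_distribution.
by apply: eq_measure_integral => A mA _; exact: law.
Qed.

(** Independence says that the joint law agrees with the product measure on rectangles, hence on all
    measurable sets; Tonelli then gives the iterated integral. *)
Lemma integral_pair_law i j (F : T * T -> \bar R) : i != j ->
  measurable_fun setT F -> (forall x, 0 <= F x) ->
  \int[P]_w F (X i w, X j w) = \int[mu]_x \int[mu]_y F (x, y).
Proof.
move=> ij mF F0; pose Z w := (X i w, X j w).
have mZ : measurable_fun setT Z by exact: measurable_fun_pair.
rewrite -[RHS](@fubini_tonelli1 _ _ _ _ _ mu mu)//.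
transitivity (\int[pushforward P Z]_z F z).
  by rewrite ge0_integral_pushforward.
apply: eq_measure_integral => A mA _.
pose PZ : {measure set (T * T)%type -> \bar R} := pushforward P Z.
apply/esym/(@product_measure_unique _ _ _ _ _ mu mu (PZ mZ)) => // B C mB mC.
by rewrite /PZ/= /pushforward -(pairwise_indep ij mB mC).
Qed.

(** Expanding the square involves only pairs of variables, so pairwise independence suffices: the
    off-diagonal terms sum to the square of the mean and only the diagonal survives. *)
Lemma variance_sum_le (u : T -> R) (m : R) N : measurable_fun setT u ->
  (forall x, 0 <= u x)%R -> \int[mu]_x (u x)%:E = m%:E ->
  \int[P]_w (((\sum_(k < N) u (X k w)) - N%:R * m) ^+ 2)%:E <=
    N%:R%:E * \int[mu]_x (u x ^+ 2)%:E.
Proof.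
move=> mfu u0 um.
have m0 : (0 <= m)%R by rewrite -lee_fin -um integral_ge0// => x _; rewrite lee_fin.
case: N => [|N].
  rewrite mul0e integral0_eq// => w _; rewrite big_ord0 mul0r subr0 expr0n//.
have Vge0 : 0 <= \int[mu]_x (u x ^+ 2)%:E.
  by apply: integral_ge0 => x _; rewrite lee_fin sqr_ge0.
case VE : (\int[mu]_x (u x ^+ 2)%:E) Vge0 => [v| |//] v0; last first.
  by rewrite gt0_muley ?lte_fin// leey.
set n := N.+1.
have muX k : measurable_fun setT (fun w => u (X k w)).
  exact: (measurableT_comp mfu).
pose S w := (\sum_(k < n) u (X k w))%R.
have mS : measurable_fun setT S by apply: measurable_sum.
have S0 w : (0 <= S w)%R by apply: sumr_ge0.
have ES : \int[P]_w (S w)%:E = (n%:R * m)%:E.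
  under eq_integral do rewrite /S -sumEFin.
  rewrite ge0_integral_sum//; last 2 first.
  - by move=> k; exact/measurable_EFinP.
  - by move=> k w _; rewrite lee_fin.
  rewrite (eq_bigr (fun=> m%:E)); last first.
    move=> k _; rewrite -um; apply: (@integral_law k (EFin \o u)) => [|x].
      exact/measurable_EFinP.
    by rewrite lee_fin.
  by rewrite sumEFin sumr_const card_ord mulr_natl.
(* On the diagonal the nonnegative [m ^+ 2] is added for free, so that summing over all pairs gives
   [n * v + (n * m) ^+ 2]. *)
have Eij (i j : nat) : \int[P]_w (u (X i w) * u (X j w))%:E <=
    ((if i == j then v else 0) + m ^+ 2)%:E.
  have [->|ij] := eqVneq i j.
    rewrite EFinD -VE -[leLHS]adde0; apply: leeD; last by rewrite lee_fin sqr_ge0.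
    rewrite (@integral_law j (fun x => (u x * u x)%:E))//.
    + exact/measurable_EFinP/measurable_funM.
    + by move=> x; rewrite lee_fin mulr_ge0.
  rewrite (@integral_pair_law i j (fun z => (u z.1 * u z.2)%:E))//; last 2 first.
  - apply/measurable_EFinP/measurable_funM.
    + exact: (measurableT_comp mfu).
    + exact: (measurableT_comp mfu).
  - by move=> z; rewrite lee_fin mulr_ge0.
  rewrite add0r expr2 EFinM -{1}um -ge0_integralZr//; last 2 first.
  - exact/measurable_EFinP.
  - by move=> x _; rewrite lee_fin.
  rewrite le_eqVlt; apply/orP; left; apply/eqP; apply: eq_integral => x _.
  rewrite -um -ge0_integralZl//.
  - exact/measurable_EFinP.
  - by move=> y _; rewrite lee_fin.
  - by rewrite lee_fin.
have ES2 : \int[P]_w (S w ^+ 2)%:E <= (n%:R * v + (n%:R * m) ^+ 2)%:E.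
  rewrite (_ : (fun w => _) = fun w =>
    \sum_(i < n) \sum_(j < n) (u (X i w) * u (X j w))%:E); last first.
    apply/funext => w; rewrite expr2 /S mulr_suml -sumEFin; apply: eq_bigr => i _.
    by rewrite mulr_sumr -sumEFin.
  rewrite ge0_integral_sum//; last 2 first.
  - by move=> i; apply: emeasurable_sum => j; exact/measurable_EFinP/measurable_funM.
  - by move=> i w _; apply: sume_ge0 => j _; rewrite lee_fin mulr_ge0.
  apply: (@le_trans _ _ (\sum_(i < n) \sum_(j < n) ((if i == j :> nat then v else 0) + m ^+ 2)%:E)).
    apply: lee_sum => i _; rewrite ge0_integral_sum//.
    - by apply: lee_sum => j _; exact: Eij.
    - by move=> j; exact/measurable_EFinP/measurable_funM.
    - by move=> j w _; rewrite lee_fin mulr_ge0.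
  under eq_bigr do rewrite sumEFin.
  rewrite sumEFin lee_fin.
  rewrite (eq_bigr (fun=> v + n%:R * m ^+ 2)%R); last first.
    move=> i _; rewrite big_split/= sumr_const card_ord mulr_natl; congr (_ + _)%R.
    by rewrite -big_mkcond/= (big_pred1 i)// => j; rewrite /= eq_sym.
  rewrite sumr_const card_ord -[leLHS]mulr_natl.
  by rewrite le_eqVlt; apply/orP; left; apply/eqP; ring.
have mS2 : measurable_fun setT (fun w => (S w ^+ 2)%:E).
  exact/measurable_EFinP/measurable_funX.
(* The expansion [(S - c) ^+ 2 + 2 * c * S = S ^+ 2 + c ^+ 2] with [c = n * m] has nonnegative terms
   on both sides, so it integrates without any integrability condition. *)
have key : \int[P]_w (((S w) - n%:R * m) ^+ 2)%:E +
    (2 * (n%:R * m) * (n%:R * m))%:E = \int[P]_w (S w ^+ 2)%:E + ((n%:R * m) ^+ 2)%:E.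
  have nm0 : (0 <= 2 * (n%:R * m))%R by rewrite !mulr_ge0.
  transitivity (\int[P]_w ((((S w) - n%:R * m) ^+ 2)%:E + (2 * (n%:R * m))%:E * (S w)%:E)).
    rewrite ge0_integralD//.
    - rewrite ge0_integralZl//.
      + by rewrite ES.
      + exact/measurable_EFinP.
      + by move=> w _; rewrite lee_fin.
    - by move=> w _; rewrite lee_fin sqr_ge0.
    - by apply/measurable_EFinP/measurable_funX; exact: measurable_funB.
    - by move=> w _; rewrite mule_ge0// lee_fin.
    - by apply: emeasurable_funM => //; exact/measurable_EFinP.
  transitivity (\int[P]_w ((S w ^+ 2)%:E + ((n%:R * m) ^+ 2)%:E)).
    apply: eq_integral => w _; rewrite -EFinM -!EFinD; congr EFin.
    by ring.
  rewrite ge0_integralD//.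
  - by rewrite integral_probability_cst.
  - by move=> w _; rewrite lee_fin sqr_ge0.
  - by move=> w _; rewrite lee_fin sqr_ge0.
have : \int[P]_w (((S w) - n%:R * m) ^+ 2)%:E + (2 * (n%:R * m) * (n%:R * m))%:E <=
   (n%:R * v)%:E + (2 * (n%:R * m) * (n%:R * m))%:E.
  rewrite key; apply: (le_trans (leeD2r _ ES2)).
  by rewrite -!EFinD lee_fin le_eqVlt; apply/orP; left; apply/eqP; ring.
by rewrite leeD2rE// -EFinM.
Qed.

(** The factor [5 / 2] is [1 / 2] from the variance of the bounded part plus [1] each for the
    empirical mean and the expectation of the tail. The term [tau / 2] is what AM-GM leaves. *)
Lemma L1_empirical_mean (g : T -> R) (m r tau : R) N :
  measurable_fun setT g -> (forall x, 0 <= g x)%R ->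
  \int[mu]_x (g x)%:E = m%:E -> (1 < r)%R -> (r <= 2)%R -> (0 < tau)%R ->
  (1 <= N)%N ->
  \int[P]_w (`| N%:R^-1 * (\sum_(k < N) g (X k w)) - m |)%:E <=
   (N%:R `^ (r^-1 - 1))%:E *
     ((5 / 2 * tau `^ (1 - r))%:E * \int[mu]_x (g x `^ r)%:E + (tau / 2)%:E).
Proof.
move=> mg g0 gm r1 r2 tau0 N1.
have n0 : (0 < N%:R :> R)%R by rewrite ltr0n.
set n : R := N%:R in n0 *.
have nN0 : n != 0%R by rewrite gt_eqF.
have r0 : (0 < r)%R by apply: lt_trans r1.
(* [T0] is the truncation level. The AM-GM scale [c] equals [T0 / n], which gives the variance term
   the same power [n ^ (r^-1 - 1)] as the other terms. *)
pose T0 := (n `^ r^-1 * tau)%R.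
pose c := (n `^ (r^-1 - 1) * tau)%R.
have T00 : (0 < T0)%R by rewrite mulr_gt0// powR_gt0.
have c0 : (0 < c)%R by rewrite mulr_gt0// powR_gt0.
pose u x := if (g x <= T0)%R then g x else 0%R.
pose v x := if (g x <= T0)%R then 0%R else g x.
have guv x : g x = (u x + v x)%R by rewrite /u /v; case: ifP => _; rewrite ?addr0 ?add0r.
have u0 x : (0 <= u x)%R by rewrite /u; case: ifP.
have v0 x : (0 <= v x)%R by rewrite /v; case: ifP.
have mb : measurable_fun setT (fun x => g x <= T0)%R by exact: measurable_fun_ler.
have mfu : measurable_fun setT u by exact: measurable_fun_ifT.
have mfv : measurable_fun setT v by exact: measurable_fun_ifT.
have gr0 x : 0 <= (g x `^ r)%:E by rewrite lee_fin powR_ge0.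
have mgr : measurable_fun setT (fun x => (g x `^ r)%:E).
  by apply/measurable_EFinP; exact: (measurableT_comp (measurable_powR r)).
(* Where [g > T0], write [g = g ^ (1 - r) * g ^ r]; the first exponent is negative, so the first
   factor is at most [T0 ^ (1 - r)]. *)
have vle x : (v x <= T0 `^ (1 - r) * g x `^ r)%R.
  rewrite /v; case: (leP (g x) T0) => [_|gT]; first by rewrite mulr_ge0 ?powR_ge0.
  have gx0 : (0 < g x)%R by apply: lt_trans gT.
  rewrite -{1}(powRr1 (g0 x)) -{1}(subrK r 1%R) powRD ?(lt0r_neq0 gx0) ?implybT//.
  rewrite ler_wpM2r ?powR_ge0//.
  rewrite -(opprB r 1%R) !powRN lef_pV2 ?posrE ?powR_gt0//.
  by rewrite ge0_ler_powR ?nnegrE ?subr_ge0 ?ltW.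
(* Where [g <= T0], write [g ^ 2 = g ^ (2 - r) * g ^ r]; here [r <= 2] makes the first factor at
   most [T0 ^ (2 - r)]. *)
have ule x : (u x ^+ 2 <= T0 `^ (2 - r) * g x `^ r)%R.
  rewrite /u; case: (leP (g x) T0) => [gT|_]; last first.
    by rewrite expr0n mulr_ge0 ?powR_ge0.
  have [gx0|gx0] := eqVneq (g x) 0%R.
    by rewrite gx0 expr0n mulr_ge0 ?powR_ge0.
  rewrite -powR_mulrn// -{1}(subrK r 2%:R) powRD ?gx0 ?implybT//.
  by rewrite ler_wpM2r ?powR_ge0// ge0_ler_powR ?nnegrE ?subr_ge0 ?(ltW T00).
have le_m (w : T -> R) : measurable_fun setT w -> (forall x, 0 <= w x)%R ->
    (forall x, w x <= g x)%R -> exists2 mw : R, (0 <= mw)%R & \int[mu]_x (w x)%:E = mw%:E.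
  move=> mw w0 wg; have i0 : 0 <= \int[mu]_x (w x)%:E.
    by apply: integral_ge0 => x _; rewrite lee_fin.
  have ifin : \int[mu]_x (w x)%:E \is a fin_num.
    rewrite ge0_fin_numE//; apply: (@le_lt_trans _ _ m%:E); last exact: ltry.
    by rewrite -gm; apply: le_integral_pointwise => x; rewrite lee_fin.
  by exists (fine (\int[mu]_x (w x)%:E)); rewrite ?fine_ge0// fineK.
have [p p0 pE] : exists2 p : R, (0 <= p)%R & \int[mu]_x (u x)%:E = p%:E.
  by apply: le_m => // x; rewrite guv lerDl.
have [q q0 qE] : exists2 q : R, (0 <= q)%R & \int[mu]_x (v x)%:E = q%:E.
  by apply: le_m => // x; rewrite guv lerDr.
have mpq : m = (p + q)%R.
  apply: EFin_inj; rewrite EFinD -gm -pE -qE -ge0_integralD//.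
  - by apply: eq_integral => x _; rewrite guv EFinD.
  - by move=> x _; rewrite lee_fin.
  - exact/measurable_EFinP.
  - by move=> x _; rewrite lee_fin.
  - exact/measurable_EFinP.
set G := \int[mu]_x (g x `^ r)%:E.
have G0 : 0 <= G by exact: integral_ge0.
have qle : q%:E <= (T0 `^ (1 - r))%:E * G.
  rewrite -qE -ge0_integralZl ?lee_fin ?powR_ge0//.
  by apply: le_integral_pointwise => x; rewrite lee_fin.
pose Su w := (\sum_(k < N) u (X k w))%R.
pose Sv w := (\sum_(k < N) v (X k w))%R.
have mXk (h : T -> R) k : measurable_fun setT h -> measurable_fun setT (fun w => h (X k w)).
  by move=> mh; exact: (measurableT_comp mh).
have mSu : measurable_fun setT Su by apply: measurable_sum => k; exact: mXk.
have mSv : measurable_fun setT Sv by apply: measurable_sum => k; exact: mXk.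
have Sv0 w : (0 <= Sv w)%R by apply: sumr_ge0.
have ESv : \int[P]_w (Sv w)%:E = (n * q)%:E.
  under eq_integral do rewrite /Sv -sumEFin.
  rewrite ge0_integral_sum//; last 2 first.
  - by move=> k; apply/measurable_EFinP; exact: mXk.
  - by move=> k w _; rewrite lee_fin.
  rewrite (eq_bigr (fun=> q%:E)); last first.
    move=> k _; rewrite -qE; apply: (@integral_law k (EFin \o v)) => [|x].
      exact/measurable_EFinP.
    by rewrite lee_fin.
  by rewrite sumEFin sumr_const card_ord mulr_natl.
pose D w := ((Su w - n * p) ^+ 2)%R.
have mD : measurable_fun setT (fun w => (D w)%:E).
  by apply/measurable_EFinP/measurable_funX; exact: measurable_funB.
have ED : \int[P]_w (D w)%:E <= (n * T0 `^ (2 - r))%:E * G.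
  apply: (le_trans (variance_sum_le N mfu u0 pE)).
  rewrite EFinM -muleA; apply: lee_wpmul2l; first by rewrite lee_fin ltW.
  rewrite -ge0_integralZl ?lee_fin ?powR_ge0//.
  by apply: le_integral_pointwise => x; rewrite lee_fin// sqr_ge0.
pose al := (n ^-2 / (2 * c))%R.
have al0 : (0 <= al)%R.
  by apply: divr_ge0; [rewrite invr_ge0 exprn_ge0// ltW|apply: mulr_ge0 => //; exact: ltW].
(* AM-GM: |z| <= z ^ 2 / (2 c) + c / 2 *)
have pw w : (`| n^-1 * (\sum_(k < N) g (X k w)) - m | <=
    al * D w + (n^-1 * Sv w + (c / 2 + q)))%R.
  have -> : (n^-1 * (\sum_(k < N) g (X k w)) - m =
      n^-1 * (Su w - n * p) + (n^-1 * Sv w - q))%R.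
    under eq_bigr do rewrite guv.
    by rewrite big_split/= -/(Su w) -/(Sv w) mpq; field.
  apply: (le_trans (ler_normD _ _)).
  (* No cancellation is sought in the tail: its empirical mean and its expectation [q] are bounded
     separately. *)
  have h1 : (`|n^-1 * Sv w - q| <= n^-1 * Sv w + q)%R.
    apply: (le_trans (ler_normB _ _)).
    by rewrite !ger0_norm// mulr_ge0// invr_ge0 ltW.
  suff h2 : (`|n^-1 * (Su w - n * p)| <= al * D w + c / 2)%R by lra.
  set z := (n^-1 * (Su w - n * p))%R.
  have -> : (al * D w = z ^+ 2 / (2 * c))%R.
    by rewrite /al /D /z; field; rewrite nN0 gt_eqF.
  rewrite -(real_normK (num_real z)) -subr_ge0.
  have -> : (`|z| ^+ 2 / (2 * c) + c / 2 - `|z| = (`|z| - c) ^+ 2 / (2 * c))%R.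
    by field; rewrite gt_eqF.
  by rewrite divr_ge0 ?sqr_ge0// mulr_ge0// ltW.
have n1Sv0 w : 0 <= (n^-1)%:E * (Sv w)%:E by rewrite mule_ge0// lee_fin// invr_ge0 ltW.
have D0 w : 0 <= (D w)%:E by rewrite lee_fin sqr_ge0.
have cq0 : (0 <= c / 2 + q)%R by rewrite addr_ge0// divr_ge0// ltW.
apply: (@le_trans _ _ (\int[P]_w (al%:E * (D w)%:E + ((n^-1)%:E * (Sv w)%:E + (c / 2 + q)%:E)))).
  by apply: le_integral_pointwise => w; rewrite lee_fin.
have mn1Sv : measurable_fun setT (fun w => (n^-1)%:E * (Sv w)%:E).
  by apply: emeasurable_funM => //; exact/measurable_EFinP.
rewrite ge0_integralD//; last 4 first.
- by move=> w _; rewrite mule_ge0// lee_fin.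
- exact: emeasurable_funM.
- by move=> w _; rewrite adde_ge0// lee_fin.
- exact: emeasurable_funD.
rewrite ge0_integralD// ge0_integralZl// ge0_integralZl//; last 3 first.
- exact/measurable_EFinP.
- by move=> w _; rewrite lee_fin.
- by rewrite lee_fin invr_ge0 ltW.
rewrite ESv integral_probability_cst.
have -> : (n^-1)%:E * (n * q)%:E = q%:E by rewrite -EFinM mulKf.
apply: (@le_trans _ _ (al%:E * ((n * T0 `^ (2 - r))%:E * G) +
    ((T0 `^ (1 - r))%:E * G + ((c / 2)%:E + (T0 `^ (1 - r))%:E * G)))).
  apply: leeD; first by apply: lee_wpmul2l.
  by apply: leeD => //; rewrite EFinD; apply: leeD2l.
have npow a : (0 < n `^ a)%R by rewrite powR_gt0.
have tpow a : (0 < tau `^ a)%R by rewrite powR_gt0.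
have nD a a' : (n `^ (a + a') = n `^ a * n `^ a')%R by rewrite powRD// nN0 implybT.
have tD a a' : (tau `^ (a + a') = tau `^ a * tau `^ a')%R.
  by rewrite powRD// (lt0r_neq0 tau0) implybT.
have n_1 : (n^-1 = n `^ (- 1))%R by rewrite powR_inv1// ltW.
have nI a : ((n `^ a)^-1 = n `^ (- a))%R by rewrite powRN.
have TE a : (T0 `^ a = n `^ (r^-1 * a) * tau `^ a)%R.
  by rewrite /T0 powRM ?powR_ge0 ?(ltW tau0)// -powRrM.
have E2 : (T0 `^ (1 - r) = n `^ (r^-1 - 1) * tau `^ (1 - r))%R.
  by rewrite TE; congr (n `^ _ * _)%R; field; rewrite gt_eqF.
have E1 : (al * (n * T0 `^ (2 - r)) = n `^ (r^-1 - 1) * (tau `^ (1 - r) / 2))%R.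
  have -> : (al * (n * T0 `^ (2 - r)) =
      n^-1 * (n `^ (r^-1 - 1))^-1 * n `^ (r^-1 * (2 - r)) *
      (tau `^ (1 - r + 1) * tau^-1) / 2)%R.
    rewrite TE /al /c (_ : 1 - r + 1 = 2 - r)%R; last by ring.
    by field; rewrite nN0 !gt_eqF.
  rewrite n_1 nI -!nD tD powRr1 ?(ltW tau0)// mulfK ?gt_eqF//.
  by rewrite -mulrA; congr (n `^ _ * _)%R; field; rewrite gt_eqF.
rewrite muleA -EFinM E1 E2 /c.
(* If the [r]-th moment is infinite, so is the right side, because its factors are positive. *)
case: (G) G0 => [G'| |//] G'0; last first.
  rewrite [leRHS](_ : _ = +oo) ?leey//.
  rewrite (gt0_muley (x := (5 / 2 * tau `^ (1 - r))%:E)).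
    by rewrite addye// gt0_muley// lte_fin.
  by rewrite lte_fin mulr_gt0// divr_gt0.
rewrite -!EFinM -!EFinD. rewrite lee_fin le_eqVlt; apply/orP; left; apply/eqP.
by field.
Qed.

End iid.

(** * One-dimensional integrals *)

Section one_dim.
Context {R : realType}.
Implicit Types a q s x : R.

Lemma is_derive_powR_shift a x : 0 <= x -> 1 < a ->
  is_derive x (1 : R) (fun y : R => (1 - a)^-1 * (1 + y) `^ (1 - a))
    ((1 + x) `^ (- a)).
Proof.
move=> x0 a1; have x1 : 0 < 1 + x by rewrite ltr_pwDl.
have H1 : is_derive x (1:R) (fun y : R => 1 + y) 1.
  by apply: is_derive_eq; rewrite add0r mulr1.
have H2 := is_derive1_powR (1 - a) x1.
have H3 := @is_derive1_comp _ (fun y => y `^ (1 - a)) (fun y : R => 1 + y) x _ _ H2 H1.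
have H4 := is_deriveZ (1 - a)^-1 H3.
apply: (@is_derive_eq _ _ _ _ _ _ _ _ H4).
rewrite mulr1 /GRing.scale/= mulrA mulVf; last by rewrite subr_eq0 lt_eqF.
by rewrite mul1r; congr (_ `^ _); ring.
Qed.

Lemma continuous_powR_norm a : continuous (fun t : R => (1 + `|t|) `^ a).
Proof.
move=> t; rewrite (_ : (fun _ => _) = (fun t : R => expR (a * ln (1 + `|t|)))); last first.
  by apply/funext => u; rewrite /powR gt_eqF// ltr_pwDl.
have c1 : {for (t : R), continuous (fun t : R => 1 + `|t|)}.
  by apply: (@cvgD _ R^o); [exact: cvg_cst|exact: norm_continuous].
have c2 : {for (t : R), continuous (fun t : R => ln (1 + `|t|))}.
  have := @continuous_comp R R R (fun t : R => 1 + `|t| : R) (@ln R) t c1. apply.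
  by apply: continuous_ln; rewrite ltr_pwDl.
have c3 : {for (t : R), continuous (fun t : R => a * ln (1 + `|t|))}.
  by apply: cvgM; [exact: cvg_cst|exact: c2].
apply: (@continuous_comp _ _ _ (fun t : R => a * ln (1 + `|t|)) expR) => //.
exact: continuous_expR.
Qed.

Lemma measurable_powR_norm a :
  measurable_fun setT ((fun t : R => (1 + `|t|) `^ a) : measurableTypeR R -> measurableTypeR R).
Proof. by apply: continuous_measurable_fun; exact: continuous_powR_norm. Qed.

Lemma powR_cvg_pinfty a : a < 0 -> (1 + x) `^ a @[x --> +oo%R] --> (0 : R).
Proof.
move=> a0; apply/cvgrPdist_lt => e e0.
have na0 : 0 < - a by rewrite oppr_gt0.
near=> x.
have x2 : e^-1 `^ (- a)^-1 < x.
  near: x. by apply: nbhs_pinfty_gt; rewrite num_real.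
have x0 : e^-1 `^ (- a)^-1 < 1 + x by apply: (lt_trans x2); rewrite ltrDr.
have x1 : 0 < 1 + x by apply: le_lt_trans x0; rewrite powR_ge0.
rewrite sub0r normrN ger0_norm ?powR_ge0//.
rewrite -(opprK a) powRN -(invrK e) ltf_pV2 ?posrE ?powR_gt0 ?invr_gt0//.
have -> : e^-1 = (e^-1 `^ (- a)^-1) `^ (- a).
  by rewrite -powRrM mulVf ?gt_eqF// powRr1// invr_ge0 ltW.
by rewrite gt0_ltr_powR ?nnegrE ?powR_ge0 ?(ltW x1).
Unshelve. all: by end_near. Qed.

(** By symmetry it suffices to integrate over the half-line, where [F] is an explicit
    antiderivative; it tends to zero at infinity because [1 - a < 0]. *)
Lemma integral_powR_norm_lty a : 1 < a ->
  (\int[@lebesgue_measure R]_t (((1 + `|t|) `^ (- a))%:E) < +oo)%E.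
Proof.
move=> a1.
rewrite ge0_symfun_integralT//; last 2 first.
- exact: continuous_powR_norm.
- by move=> x /=; rewrite normrN.
rewrite -set_itvcy.
pose F y := (1 - a)^-1 * (1 + y) `^ (1 - a).
rewrite (@ge0_continuous_FTC2y R _ F 0 0)//.
- by rewrite lte_mul_pinfty// ltry.
- by apply: continuous_subspaceT; exact: continuous_powR_norm.
- rewrite -(mulr0 (1 - a)^-1); apply: cvgM; first exact: cvg_cst.
  by apply: powR_cvg_pinfty; rewrite subr_lt0.
- by move=> x x0; have [] := is_derive_powR_shift (ltW x0) a1.
- apply: cvg_at_right_filter.
  have [dF _] := is_derive_powR_shift (lexx 0) a1.
  by apply: differentiable_continuous; exact/derivable1_diffP.
- move=> x; rewrite in_itv/= andbT => x0; rewrite derive1E.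
  have [_ ->] := is_derive_powR_shift (ltW x0) a1.
  by rewrite ger0_norm// ltW.
Qed.

(** Since [(1 + |x|) ^ q <= expR (q * |x|)], it remains to complete a square: [q^2 s^2 - q |x| + x^2
    / (4 s^2) = (|x| / (2 s) - q s)^2]. Half of the Gaussian decay is spent, which doubles the
    variance. *)
Lemma powR_norm_normal_pdf_le q s x : 0 <= q -> 0 < s ->
  (1 + `|x|) `^ q * normal_pdf 0 s x <=
  normal_peak s * expR (q ^+ 2 * s ^+ 2) / normal_peak (Num.sqrt 2 * s) *
  normal_pdf 0 (Num.sqrt 2 * s) x.
Proof.
move=> q0 s0; have s20 : Num.sqrt 2 * s != 0 by rewrite mulf_neq0 ?gt_eqF// sqrtr_gt0.
rewrite (normal_pdfE 0 (lt0r_neq0 s0)) (normal_pdfE 0 s20) /=.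
rewrite [leRHS]mulrA divfK; last first.
  by rewrite gt_eqF// normal_peak_gt0.
rewrite mulrCA -mulrA ler_wpM2l ?normal_peak_ge0//.
rewrite /normal_fun exprMn sqr_sqrtr// subr0.
apply: (@le_trans _ _ (expR (q * `|x|) * expR (- x ^+ 2 / (s ^+ 2 *+ 2)))).
  rewrite ler_wpM2r ?expR_ge0// /powR gt_eqF ?ltr_pwDl//.
  by rewrite ler_expR ler_wpM2l// le_ln1Dx// (lt_le_trans _ (normr_ge0 x)).
rewrite -!expRD ler_expR -(real_normK (num_real x)) -subr_ge0.
rewrite [leRHS](_ : _ = (`|x| / (2 * s) - q * s) ^+ 2) ?sqr_ge0//.
by field; rewrite gt_eqF.
Qed.

Lemma integral_powR_norm_normal_lty q s : 0 <= q -> 0 < s ->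
  (\int[@lebesgue_measure R]_t
     ((1 + `|t|) `^ q * normal_pdf 0 s t)%:E < +oo)%E.
Proof.
move=> q0 s0.
set c := normal_peak s * expR (q ^+ 2 * s ^+ 2) / normal_peak (Num.sqrt 2 * s).
have c0 : 0 <= c by rewrite divr_ge0 ?mulr_ge0 ?normal_peak_ge0 ?expR_ge0.
apply: (@le_lt_trans _ _ (\int[@lebesgue_measure R]_t
   (c%:E * (normal_pdf 0 (Num.sqrt 2 * s) t)%:E))%E).
  apply: le_integral_pointwise => x; rewrite lee_fin.
    by rewrite mulr_ge0 ?powR_ge0 ?normal_pdf_ge0.
  exact: powR_norm_normal_pdf_le.
rewrite ge0_integralZl//.
- by rewrite integral_normal_pdf mule1 ltry.
- by apply/measurable_EFinP; exact: measurable_normal_pdf.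
- by move=> x _; rewrite lee_fin normal_pdf_ge0.
Qed.

End one_dim.

(** * The Euclidean norm on tuples *)

Section vnorm.
Context {R : realType} {d : nat}.
Implicit Types x y z : d.-tuple R.

Lemma vnorm_ge0 x : 0 <= vnorm x. Proof. exact: sqrtr_ge0. Qed.

Lemma sqr_vnorm x : vnorm x ^+ 2 = \sum_(i < d) tnth x i ^+ 2.
Proof. by rewrite sqr_sqrtr// sumr_ge0// => i _; rewrite sqr_ge0. Qed.

(** Serves sums and differences alike, since [(u + v)^2] and [(u - v)^2] are both at most
    [2 (u^2 + v^2)] in each coordinate. *)
Lemma vnorm_le2max x y z :
  (forall i, tnth z i ^+ 2 <= 2 * (tnth x i ^+ 2 + tnth y i ^+ 2)) ->
  vnorm z <= 2 * Num.max (vnorm x) (vnorm y).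
Proof.
move=> h; set m := Num.max _ _.
have m0 : 0 <= m by rewrite le_max vnorm_ge0.
rewrite -ler_sqr ?nnegrE ?vnorm_ge0 ?mulr_ge0// sqr_vnorm.
apply: (@le_trans _ _ (2 * (vnorm x ^+ 2 + vnorm y ^+ 2))).
  by rewrite !sqr_vnorm -big_split/= mulr_sumr; apply: ler_sum.
have hx : vnorm x ^+ 2 <= m ^+ 2.
  by rewrite ler_sqr ?nnegrE ?vnorm_ge0// le_max lexx.
have hy : vnorm y ^+ 2 <= m ^+ 2.
  by rewrite ler_sqr ?nnegrE ?vnorm_ge0// le_max lexx orbT.
rewrite exprMn; lra.
Qed.

Lemma vnorm_vsub_le x y : vnorm (vsub x y) <= 2 * Num.max (vnorm x) (vnorm y).
Proof.
apply: vnorm_le2max => i; rewrite tnth_mktuple.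
by have := sqr_ge0 (tnth x i + tnth y i); lra.
Qed.

Lemma vnorm_vadd_le x y : vnorm (vadd x y) <= 2 * Num.max (vnorm x) (vnorm y).
Proof.
apply: vnorm_le2max => i; rewrite tnth_mktuple.
by have := sqr_ge0 (tnth x i - tnth y i); lra.
Qed.

Lemma powR_vnorm_vsub_le (p : R) x y : 0 <= p ->
  vnorm (vsub x y) `^ p <= 2 `^ p * (1 + vnorm x) `^ p + 2 `^ p * (1 + vnorm y) `^ p.
Proof.
move=> p0; rewrite -mulrDr.
have m0 : 0 <= Num.max (vnorm x) (vnorm y) by rewrite le_max vnorm_ge0.
apply: (@le_trans _ _ ((2 * Num.max (vnorm x) (vnorm y)) `^ p)).
  by rewrite ge0_ler_powR ?nnegrE ?vnorm_ge0 ?mulr_ge0// vnorm_vsub_le.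
rewrite powRM// ler_wpM2l ?powR_ge0//.
have h z : vnorm z `^ p <= (1 + vnorm z) `^ p.
  by rewrite ge0_ler_powR ?nnegrE ?vnorm_ge0 ?addr_ge0 ?vnorm_ge0// lerDr.
case: (leP (vnorm x) (vnorm y)) => _.
  by apply: (le_trans (h y)); rewrite lerDr powR_ge0.
by apply: (le_trans (h x)); rewrite lerDl powR_ge0.
Qed.

Lemma powR_vnorm_vadd_le (q : R) x y : 0 <= q ->
  (1 + vnorm (vadd x y)) `^ q <= 2 `^ q * ((1 + vnorm x) `^ q * (1 + vnorm y) `^ q).
Proof.
move=> q0; have x0 := vnorm_ge0 x; have y0 := vnorm_ge0 y.
rewrite -!powRM ?mulr_ge0 ?addr_ge0//.
rewrite ge0_ler_powR ?nnegrE ?addr_ge0 ?mulr_ge0 ?addr_ge0 ?vnorm_ge0//.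
apply: (@le_trans _ _ (1 + 2 * Num.max (vnorm x) (vnorm y))).
  by rewrite lerD2l vnorm_vadd_le.
by case: (leP (vnorm x) (vnorm y)) => _; nra.
Qed.

Lemma norm_tnth_le x i : `|tnth x i| <= vnorm x.
Proof.
rewrite -ler_sqr ?nnegrE ?vnorm_ge0// sqr_vnorm real_normK ?num_real//.
by rewrite (bigD1 i)//= lerDl sumr_ge0// => j _; rewrite sqr_ge0.
Qed.

(** The Euclidean norm is at most the sum of the [|x_i|], and one plus that sum is among the terms
    of the expanded product. This makes radial growth integrable coordinate by coordinate. *)
Lemma vnorm_le_tprod x : 1 + vnorm x <= tprod (fun t => 1 + `|t|) x.
Proof.
have h1 : vnorm x <= \sum_(i < d) `|tnth x i|.
  rewrite -ler_sqr ?nnegrE ?vnorm_ge0 ?sumr_ge0// sqr_vnorm.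
  have : \sum_(i < d) tnth x i ^+ 2 <= (\sum_(i < d) `|tnth x i|) ^+ 2 /\
      0 <= \sum_(i < d) `|tnth x i|.
    elim/big_rec2: _ => [|i a b _ [IH b0]]; first by rewrite expr0n.
    have n0 := normr_ge0 (tnth x i); split; last by rewrite addr_ge0.
    by rewrite -(real_normK (num_real (tnth x i))); nra.
  by case.
apply: (@le_trans _ _ (1 + \sum_(i < d) `|tnth x i|)); first by rewrite lerD2l.
rewrite /tprod.
have : 1 + \sum_(i < d) `|tnth x i| <= \prod_(i < d) (1 + `|tnth x i|) /\
    0 <= \sum_(i < d) `|tnth x i|.
  elim/big_rec2: _ => [|i a b _ [IH a0]]; first by rewrite addr0.
  have n0 := normr_ge0 (tnth x i).
  by split; [nra|rewrite addr_ge0].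
by case.
Qed.

Lemma powR_tprod (h : R -> R) (s : R) x : (forall t, 0 <= h t) ->
  (tprod h x) `^ s = tprod (fun t => h t `^ s) x.
Proof.
move=> h0; rewrite /tprod.
have : \prod_(i < d) h (tnth x i) `^ s = (\prod_(i < d) h (tnth x i)) `^ s /\
   0 <= \prod_(i < d) h (tnth x i).
  elim/big_rec2: _ => [|i a b _ [IH b0]]; first by rewrite powR1.
  by split; [rewrite IH powRM|rewrite mulr_ge0].
by case.
Qed.

Lemma measurable_vnorm : measurable_fun setT (@vnorm R d : d.-tuple R -> R).
Proof.
rewrite (_ : @vnorm R d = fun x => (\sum_(i < d) tnth x i ^+ 2) `^ 2^-1); last first.
  by apply/funext => x; rewrite powR12_sqrt// sumr_ge0// => i _; rewrite sqr_ge0.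
apply: (measurableT_comp (measurable_powR _)).
apply: measurable_sum => i; apply: measurable_funX; exact: measurable_tnth.
Qed.

Lemma measurable_powR_vnorm (s : R) :
  measurable_fun setT ((fun x => (1 + vnorm x) `^ s) : d.-tuple R -> R).
Proof.
apply: (measurableT_comp (measurable_powR s)).
by apply: measurable_funD => //; exact: measurable_vnorm.
Qed.

Lemma measurable_vsub_pair :
  measurable_fun setT ((fun u => vsub u.2 u.1) : d.-tuple R * d.-tuple R -> d.-tuple R).
Proof.
apply/measurable_fun_tnthP => i.
rewrite (_ : _ \o _ = (fun u => (tnth u.2 i - tnth u.1 i)%R)); last first.
  by apply/funext => u /=; rewrite tnth_mktuple.
apply: measurable_funB.
- by apply: (measurableT_comp (@measurable_tnth _ R d i)).
- by apply: (measurableT_comp (@measurable_tnth _ R d i)).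
Qed.

Lemma vaddK x y : vsub (vadd x y) x = y.
Proof.
apply: eq_from_tnth => i; rewrite !tnth_mktuple.
by rewrite addrC addKr.
Qed.

End vnorm.

(** * Gaussian smoothing *)

Section gaussian_density.
Local Open Scope ereal_scope.
Context {R : realType} (d : nat) (s : R).
Local Notation RM := (measurableTypeR R).
Local Notation Rd := (d.-tuple R).
Local Notation leb := (@lebesgue_measure R : {sigma_finite_measure set RM -> \bar R}).
Local Notation lint := (@prod_int R _ RM leb).
Variable L : {sigma_finite_measure set Rd -> \bar R}.
Hypothesis LE : forall f : Rd -> \bar R, measurable_fun setT f ->
  (forall t, 0 <= f t) -> \int[L]_t f t = lint f.
Hypothesis s0 : (0 < s)%R.

(** The centre is [x] and the target point is [y]. Both stay variables because the kernel is
    integrated in [x] against [mu] and in [y] against [L]. *)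
Definition gauss_pdf (x y : d.-tuple R) : R :=
  tprod (normal_pdf 0 s) (vsub y x).

Lemma gauss_pdf_ge0 x y : (0 <= gauss_pdf x y)%R.
Proof. by apply: tprod_ge0 => t; exact: normal_pdf_ge0. Qed.

Lemma gauss_pdf_le x y : (gauss_pdf x y <= normal_peak s ^+ d)%R.
Proof.
rewrite /gauss_pdf /tprod -[in leRHS](card_ord d) -prodr_const.
apply: ler_prod => i _; rewrite normal_pdf_ge0/=.
by apply: normal_pdf_ub; rewrite gt_eqF.
Qed.

Lemma measurable_gauss_pdf :
  measurable_fun setT ((fun u => gauss_pdf u.1 u.2) : Rd * Rd -> R).
Proof.
have m : measurable_fun setT (@tprod R d (normal_pdf 0 s)).
  exact: (measurable_tprod (measurable_normal_pdf 0%R s)).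
exact: (measurableT_comp m measurable_vsub_pair).
Qed.

Lemma measurable_gauss_pdf1 y : measurable_fun setT ((fun x => gauss_pdf x y) : Rd -> R).
Proof.
have m : measurable_fun setT ((fun x => (x, y)) : Rd -> Rd * Rd).
  exact: measurable_fun_pair.
exact: (measurableT_comp measurable_gauss_pdf m).
Qed.

Lemma measurable_gauss_pdf2 x : measurable_fun setT ((gauss_pdf x) : Rd -> R).
Proof.
have m : measurable_fun setT ((fun y => (x, y)) : Rd -> Rd * Rd).
  exact: measurable_fun_pair.
exact: (measurableT_comp measurable_gauss_pdf m).
Qed.

Lemma integral_gauss_pdf (x : d.-tuple R) (f : Rd -> \bar R) : measurable_fun setT f ->
  (forall t, 0 <= f t) ->
  \int[L]_y (f y * (gauss_pdf x y)%:E) =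
  lint (fun t => (tprod (normal_pdf 0 s) t)%:E * f (vadd x t)).
Proof.
move=> mf f0; have mg := measurable_gauss_pdf2 x.
have mF : measurable_fun setT (fun y => f y * (gauss_pdf x y)%:E).
  by apply: emeasurable_funM => //; exact/measurable_EFinP.
have F0 y : 0 <= f y * (gauss_pdf x y)%:E by rewrite mule_ge0// lee_fin gauss_pdf_ge0.
rewrite LE// -(prod_int_shift x)//; congr (lint _).
by apply/funext => t; rewrite muleC /gauss_pdf vaddK.
Qed.

Lemma integral_gauss_pdf1 x : \int[L]_y (gauss_pdf x y)%:E = 1.
Proof.
transitivity (\int[L]_y (cst 1 y * (gauss_pdf x y)%:E)).
  by apply: eq_integral => y _; rewrite mul1e.
rewrite (@integral_gauss_pdf x (cst 1))//.
transitivity (lint (fun t : d.-tuple R => (tprod (normal_pdf 0 s) t)%:E)).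
  by congr (lint _); apply/funext => t; rewrite mule1.
rewrite prod_int_tprod.
- by rewrite integral_normal_pdf -EFin_expe expr1n.
- exact: measurable_normal_pdf.
- by move=> t; exact: normal_pdf_ge0.
Qed.

Lemma gaussian_shiftE (x : d.-tuple R) (A : set Rd) : measurable A ->
  gaussian s [set y | A (vadd x y)] = \int[L]_y ((\1_A y)%:E * (gauss_pdf x y)%:E).
Proof.
move=> mA.
have mI : measurable_fun setT (fun y : Rd => (\1_A y : R)%:E).
  exact/measurable_EFinP/measurable_indic.
rewrite (@integral_gauss_pdf x (fun y : Rd => (\1_A y : R)%:E))//.
have mS : measurable_fun setT (fun y : Rd => (\1_A (vadd x y) : R)%:E).
  exact: (measurableT_comp mI (measurable_vadd x)).
exact: (prod_int_normal s mS).
Qed.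

Variables (mu : probability Rd R).

(** [fine] loses nothing for a probability measure when [0 < s]: the kernel is bounded by
    [normal_peak s ^+ d], so the integral is finite. *)
Definition smooth_pdf (nu : set Rd -> \bar R) (y : d.-tuple R) : R :=
  fine (\int[nu]_x (gauss_pdf x y)%:E).

Lemma smooth_pdfE y : \int[mu]_x (gauss_pdf x y)%:E = (smooth_pdf mu y)%:E.
Proof.
rewrite /smooth_pdf fineK// ge0_fin_numE; last first.
  by apply: integral_ge0 => x _; rewrite lee_fin gauss_pdf_ge0.
apply: (@le_lt_trans _ _ (\int[mu]_x (normal_peak s ^+ d)%:E)).
  apply: le_integral_pointwise => x; rewrite lee_fin ?gauss_pdf_ge0//.
  exact: gauss_pdf_le.
by rewrite integral_probability_cst ltry.
Qed.

Lemma smooth_pdf_ge0 y : (0 <= smooth_pdf mu y)%R.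
Proof.
by rewrite fine_ge0// integral_ge0// => x _; rewrite lee_fin gauss_pdf_ge0.
Qed.

Lemma measurable_smooth_pdf : measurable_fun setT (smooth_pdf mu : Rd -> R).
Proof.
apply/measurable_EFinP.
have mg : measurable_fun setT (fun u : Rd * Rd => (gauss_pdf u.1 u.2)%:E).
  by apply/measurable_EFinP; exact: measurable_gauss_pdf.
have g0 u : 0 <= (gauss_pdf u.1 u.2)%:E by rewrite lee_fin gauss_pdf_ge0.
have := @measurable_fun_fubini_tonelli_G _ _ _ _ _ mu _ mg g0.
congr measurable_fun; apply/funext => y; rewrite /fubini_G/=.
exact: smooth_pdfE.
Qed.

Lemma conv_gaussian_pdf (A : set Rd) : measurable A ->
  Defs.conv mu (gaussian s) A = \int[L]_(y in A) (smooth_pdf mu y)%:E.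
Proof.
move=> mA; rewrite /Defs.conv.
transitivity (\int[mu]_x \int[L]_y ((\1_A y)%:E * (gauss_pdf x y)%:E)).
  by apply: eq_integral => x _; exact: gaussian_shiftE.
have mI : measurable_fun setT (fun y : Rd => (\1_A y : R)%:E).
  exact/measurable_EFinP/measurable_indic.
rewrite (@fubini_tonelli _ _ _ _ _ mu L
  (fun u => (\1_A u.2)%:E * (gauss_pdf u.1 u.2)%:E)); last 2 first.
- apply: emeasurable_funM; first exact: (measurableT_comp mI).
  by apply/measurable_EFinP; exact: measurable_gauss_pdf.
- by move=> u; rewrite mule_ge0// lee_fin gauss_pdf_ge0.
rewrite [RHS]integral_mkcond; apply: eq_integral => y _ /=.
rewrite ge0_integralZl//.
- rewrite smooth_pdfE patchE indicE.
  by case: ifPn => _; rewrite ?mul1e ?mul0e.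
- by apply/measurable_EFinP; exact: measurable_gauss_pdf1.
- by move=> x _; rewrite lee_fin gauss_pdf_ge0.
Qed.

Lemma integral_smooth_pdf : \int[L]_y (smooth_pdf mu y)%:E = 1.
Proof.
rewrite -conv_gaussian_pdf// /Defs.conv.
transitivity (\int[mu]_x cst 1 x); last by rewrite integral_probability_cst.
apply: eq_integral => x _; rewrite gaussian_shiftE//.
rewrite -(integral_gauss_pdf1 x); apply: eq_integral => y _.
by rewrite indicT mul1e.
Qed.

End gaussian_density.

Section empirical.
Local Open Scope ereal_scope.
Context {R : realType} (d : nat).
Local Notation Rd := (d.-tuple R).

Lemma empirical_probability (N : nat) (xs : nat -> d.-tuple R) : (1 <= N)%N ->
  exists mu : probability Rd R,
    empirical N xs = mu :> (set Rd -> \bar R) /\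
    forall f : Rd -> \bar R, measurable_fun setT f -> (forall x, 0 <= f x) ->
      \int[mu]_x f x = (N%:R^-1)%:E * \sum_(k < N) f (xs k).
Proof.
move=> N1; have n0 : (0 < N%:R :> R)%R by rewrite ltr0n.
have n10 : (0 <= N%:R^-1 :> R)%R by rewrite invr_ge0 ltW.
pose m : {measure set Rd -> \bar R} :=
  mscale (NngNum n10) (msum (fun k => \d_(xs k : Rd)) N).
have mE : empirical N xs = m :> (set Rd -> \bar R) by [].
have [mu muE] : exists mu : probability Rd R, mu = m :> (set Rd -> \bar R).
  apply: probability_of_measure; rewrite -mE /empirical.
  rewrite (eq_bigr (fun=> 1)); last by move=> k _; rewrite diracT.
  by rewrite sumEFin sumr_const card_ord -EFinM mulVf// gt_eqF.
exists mu; split; first by rewrite muE.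
move=> f mf f0; rewrite muE ge0_integral_mscale// ge0_integral_measure_sum//.
congr (_ * _); apply: eq_bigr => k _.
by rewrite integral_dirac// diracT mul1e.
Qed.

End empirical.

Section lebesgue_tuple_measure.
Local Open Scope ereal_scope.
Context {R : realType} (d : nat).
Local Notation RM := (measurableTypeR R).
Local Notation leb := (@lebesgue_measure R : {sigma_finite_measure set RM -> \bar R}).

(* [d.-tuple R] and [d.-tuple RM] have the same sigma-algebra but different
   displays; the identity transports the measure from one to the other. *)
Lemma lebesgue_tuple_measure : exists L : {sigma_finite_measure set (d.-tuple R) -> \bar R},
  forall f : d.-tuple R -> \bar R, measurable_fun setT f -> (forall t, 0 <= f t) ->
  \int[L]_t f t = @prod_int R _ RM leb d f.
Proof.
have [L0 L0E] := tuple_measure leb d.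
have mid : measurable_fun setT ((fun x => x) : d.-tuple RM -> d.-tuple R).
  by move=> _ Y mY; rewrite setTI; exact: mY.
pose M0 : {measure set (d.-tuple R) -> \bar R} :=
  pushforward L0 ((fun x => x) : d.-tuple RM -> d.-tuple R).
have sM : sigma_finite setT (M0 mid).
  have [F FT Foo] := sigma_finiteT L0; exists F => //.
have [L LE] := sigma_finite_measureP sM.
exists L => f mf f0; rewrite LE ge0_integral_pushforward//=.
exact: (L0E f mf f0).
Qed.

End lebesgue_tuple_measure.

Section smoothed_wasserstein.
Local Open Scope ereal_scope.
Context {R : realType} (d : nat) (s : R).
Local Notation RM := (measurableTypeR R).
Local Notation Rd := (d.-tuple R).
Local Notation leb := (@lebesgue_measure R : {sigma_finite_measure set RM -> \bar R}).
Local Notation lint := (@prod_int R _ RM leb).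
Variable L : {sigma_finite_measure set Rd -> \bar R}.
Hypothesis LE : forall f : Rd -> \bar R, measurable_fun setT f ->
  (forall t, 0 <= f t) -> \int[L]_t f t = lint f.
Hypothesis s0 : (0 < s)%R.

Lemma measurable_vnorm_vsub :
  measurable_fun setT ((fun z => vnorm (vsub z.1 z.2)) : Rd * Rd -> R).
Proof.
have m : measurable_fun setT (fun z : Rd * Rd => vsub z.1 z.2 : Rd).
  exact: (measurableT_comp measurable_vsub_pair (@measurable_swap _ _ _ _)).
exact: (measurableT_comp measurable_vnorm m).
Qed.

(** Holds for each fixed sample: one coupling bounds the infimum, and the empirical measure is
    itself a probability, whose smoothed density is the mean of the kernels centred at the sample
    points. *)
Lemma wasserstein_sigma_le (N : nat) (xs : nat -> Rd) (mu : probability Rd R) (p : R) :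
  (1 <= p)%R -> (1 <= N)%N ->
  wasserstein_sigma p s (empirical N xs) mu `^ p <=
  \int[L]_y ((2 `^ p * (1 + vnorm y) `^ p) *
    `|N%:R^-1 * (\sum_(k < N) gauss_pdf s (xs k) y) - smooth_pdf s mu y|)%:E.
Proof.
move=> p1 N1; have p0 : (0 < p)%R by apply: lt_le_trans p1.
have [nu [nuE nuint]] := empirical_probability xs N1.
have nupdf y : smooth_pdf s nu y = (N%:R^-1 * (\sum_(k < N) gauss_pdf s (xs k) y))%R.
  apply: EFin_inj; rewrite -(smooth_pdfE s0) nuint.
  - by rewrite sumEFin -EFinM.
  - by apply/measurable_EFinP; exact: measurable_gauss_pdf1.
  - by move=> x; rewrite lee_fin gauss_pdf_ge0.
pose c (z : Rd * Rd) := (vnorm (vsub z.1 z.2) `^ p)%R.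
pose V (y : Rd) := (2 `^ p * (1 + vnorm y) `^ p)%R.
have V0 y : (0 <= V y)%R by rewrite mulr_ge0 ?powR_ge0.
have mV : measurable_fun setT V.
  by apply: measurable_funM => //; exact: measurable_powR_vnorm.
have c0 z : (0 <= c z)%R by rewrite powR_ge0.
have mc : measurable_fun setT c.
  exact: (measurableT_comp (measurable_powR p) measurable_vnorm_vsub).
have cxx x : c (x, x) = 0%R.
  rewrite /c/=; have -> : vnorm (vsub x x) = 0%R.
    rewrite /vnorm big1 ?sqrtr0// => i _.
    by rewrite tnth_mktuple subrr expr0n.
  by rewrite powR0// gt_eqF.
have cV x y : (c (x, y) <= V x + V y)%R.
  by rewrite /c /V; apply: powR_vnorm_vsub_le; exact: ltW.
have [P [P1 P2 Pc]] := coupling_densities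
  (smooth_pdf_ge0 s nu) (smooth_pdf_ge0 s mu)
  (measurable_smooth_pdf s0 nu) (measurable_smooth_pdf s0 mu)
  (integral_smooth_pdf LE s0 nu) (integral_smooth_pdf LE s0 mu) V0 mV c0 mc cxx cV.
(* The power [p] undoes the root [p^-1] because the infimum is nonnegative. *)
rewrite /wasserstein_sigma /wasserstein -poweRrM mulVf ?gt_eqF// poweRe1; last first.
  apply: le_ereal_inf_tmp => _ [pi _ <-].
  by apply: integral_ge0 => z _; rewrite lee_fin powR_ge0.
apply: (@le_trans _ _ (\int[P]_z (c z)%:E)).
  apply: ereal_inf_lbound; exists P => //; split => A mA.
  - by rewrite P1// nuE (conv_gaussian_pdf LE).
  - by rewrite P2// (conv_gaussian_pdf LE).
apply: (le_trans Pc); rewrite le_eqVlt; apply/orP; left; apply/eqP.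
by apply: eq_integral => y _; rewrite nupdf.
Qed.

End smoothed_wasserstein.

(** * The expected smoothed distance *)

(** The product rule on an initial segment containing [i] and [j] is applied with the whole space at
    every other index. *)
Lemma iid_seq_pairwise dO (Omega : measurableType dO) (R : realType) (d : nat)
    (P : probability Omega R) (X : nat -> {RV P >-> d.-tuple R})
    (mu : set (d.-tuple R) -> \bar R) i j (A B : set (d.-tuple R)) :
  iid_seq X mu -> i != j -> measurable A -> measurable B ->
  P (X i @^-1` A `&` X j @^-1` B) = (mu A * mu B)%E.
Proof.
move=> [law indep] ij mA mB.
pose F l := if l == i then A else if l == j then B else setT.
have mF l : measurable (F l) by rewrite /F; case: ifP => _ //; case: ifP.
pose n := (maxn i j).+1.
have ni : (i < n)%N by rewrite ltnS leq_maxl.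
have nj : (j < n)%N by rewrite ltnS leq_maxr.
have Fi : F i = A by rewrite /F eqxx.
have Fj : F j = B by rewrite /F eqxx eq_sym (negbTE ij).
have := indep n F mF; rewrite (bigD1 (Ordinal ni))//= (bigD1 (Ordinal nj))/=; last first.
  by rewrite eq_sym.
rewrite big1 ?mule1; last first.
  move=> l /andP[li lj]; rewrite law// /F.
  rewrite ifF; last by apply/negbTE.
  rewrite ifF; last by apply/negbTE.
  by rewrite -(law 0%N)// preimage_setT; exact: probability_setT.
rewrite Fi Fj !law// => <-; congr (P _); apply/seteqP; split => w /=.
  move=> [XA XB] l /= ln; rewrite /F; case: ifPn => [/eqP -> //|_].
  by case: ifPn => [/eqP -> //|_].
move=> h; split; first by rewrite -Fi; exact: h.
by rewrite -Fj; exact: h.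
Qed.

Lemma powR_1D_le (R : realType) (q v : R) : (0 <= q)%R -> (0 <= v)%R ->
  ((1 + v) `^ q <= 2 `^ q * (1 + v `^ q))%R.
Proof.
move=> q0 v0; apply: (@le_trans _ _ ((2 * Num.max 1 v) `^ q)%R).
  rewrite ge0_ler_powR ?nnegrE ?addr_ge0 ?mulr_ge0 ?le_max ?ler01//.
  by case: (leP 1%R v) => ?; lra.
rewrite powRM ?le_max ?ler01// ler_wpM2l ?powR_ge0//.
case: (leP 1%R v) => _; first by rewrite lerDr.
by rewrite powR1 lerDl powR_ge0.
Qed.

(** Raising the weight to [1 - r] makes its exponents nonnegative, so each [|y_i|] may be replaced
    by the norm. The resulting exponent [p * r + a * (r - 1) * d] is [q] by the choice of [a]. *)
Lemma weight_bound (R : realType) d (p q r a : R) (y : d.-tuple R) : (1 < r)%R ->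
  (a * (r - 1) * d%:R = q - p * r)%R -> (0 <= a)%R ->
  (1 + vnorm y) `^ p * ((1 + vnorm y) `^ (- p) *
    tprod (fun t => (1 + `|t|) `^ (- a)) y) `^ (1 - r) <= (1 + vnorm y) `^ q.
Proof.
move=> r1 aE a0; set w := tprod _ _.
have v1 : (0 < 1 + vnorm y)%R by rewrite ltr_pwDl// vnorm_ge0.
have vN0 : (1 + vnorm y != 0)%R by rewrite gt_eqF.
have w0 : (0 <= w)%R by apply: tprod_ge0 => t; exact: powR_ge0.
have vD u v : ((1 + vnorm y) `^ (u + v) = (1 + vnorm y) `^ u * (1 + vnorm y) `^ v)%R.
  by rewrite powRD// vN0 implybT.
rewrite powRM ?powR_ge0// -powRrM mulrA -vD.
have -> : (w `^ (1 - r) = tprod (fun t => (1 + `|t|) `^ (a * (r - 1))) y)%R.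
  rewrite /w powR_tprod; last by move=> t; exact: powR_ge0.
  apply: eq_bigr => i _; rewrite -powRrM; congr (_ `^ _)%R; ring.
have -> : (q = (p + - p * (1 - r)) + a * (r - 1) * d%:R)%R by rewrite aE; ring.
rewrite [leRHS]vD ler_wpM2l ?powR_ge0// powRrM powR_mulrn ?powR_ge0//.
set z := (X in _ <= X ^+ _); have -> : z ^+ d = \prod_(i < d) z by rewrite prodr_const card_ord.
apply: ler_prod => i _; rewrite powR_ge0/= ge0_ler_powR ?nnegrE ?addr_ge0 ?vnorm_ge0//.
  by rewrite mulr_ge0// subr_ge0 ltW.
by rewrite lerD2l norm_tnth_le.
Qed.

Section expectation.
Local Open Scope ereal_scope.
Context {R : realType} (d : nat) (s : R).
Local Notation RM := (measurableTypeR R).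
Local Notation Rd := (d.-tuple R).
Local Notation leb := (@lebesgue_measure R : {sigma_finite_measure set RM -> \bar R}).
Local Notation lint := (@prod_int R _ RM leb).
Variable L : {sigma_finite_measure set Rd -> \bar R}.
Hypothesis LE : forall f : Rd -> \bar R, measurable_fun setT f ->
  (forall t, 0 <= f t) -> \int[L]_t f t = lint f.
Hypothesis s0 : (0 < s)%R.

(** The inequality [1 + |x + t| <= 2 (1 + |x|) (1 + |t|)] separates the centre from the noise, and
    [vnorm_le_tprod] then factors the noise over the coordinates. *)
Lemma integral_vnorm_gauss_pdf_le (q : R) (x : Rd) : (0 <= q)%R ->
  \int[L]_y (((1 + vnorm y) `^ q)%:E * (gauss_pdf s x y)%:E) <=
  (2 `^ q * (1 + vnorm x) `^ q)%:E *
    (\int[leb]_t ((1 + `|t|) `^ q * normal_pdf 0 s t)%:E) ^+ d.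
Proof.
move=> q0; pose h t := ((1 + `|t|) `^ q * normal_pdf 0 s t)%R.
have h0 t : (0 <= h t)%R by rewrite mulr_ge0 ?powR_ge0 ?normal_pdf_ge0.
have mh : measurable_fun setT (h : RM -> RM).
  apply: measurable_funM; first exact: measurable_powR_norm.
  exact: measurable_normal_pdf.
rewrite (integral_gauss_pdf s LE); last 2 first.
- by apply/measurable_EFinP; exact: measurable_powR_vnorm.
- by move=> t; rewrite lee_fin powR_ge0.
have mth : measurable_fun setT (fun t : Rd => (tprod h t)%:E).
  by apply/measurable_EFinP; exact: (measurable_tprod mh).
have th0 (t : Rd) : 0 <= (tprod h t)%:E by rewrite lee_fin tprod_ge0.
rewrite -(prod_int_tprod d mh h0) -[X in _ * X]LE// -ge0_integralZl//; last first.
  by rewrite lee_fin mulr_ge0 ?powR_ge0.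
rewrite -LE; last 2 first.
- apply: emeasurable_funM; apply/measurable_EFinP.
    exact: (measurable_tprod (measurable_normal_pdf 0%R s)).
  have mv : measurable_fun setT (fun t : Rd => vadd x t : Rd) by exact: measurable_vadd.
  exact: (measurableT_comp (measurable_powR_vnorm q) mv).
- by move=> t; rewrite mule_ge0// lee_fin ?powR_ge0// tprod_ge0// => u; exact: normal_pdf_ge0.
apply: le_integral_pointwise => t.
  by rewrite mule_ge0// lee_fin ?powR_ge0// tprod_ge0// => u; exact: normal_pdf_ge0.
have pge0 : (0 <= tprod (normal_pdf 0 s) t)%R.
  by apply: tprod_ge0 => u; exact: normal_pdf_ge0.
rewrite -!EFinM lee_fin.
have -> : (tprod h t = tprod (fun u => (1 + `|u|) `^ q) t * tprod (normal_pdf 0 s) t)%R.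
  by rewrite /tprod -big_split.
rewrite mulrC mulrA ler_wpM2r//.
apply: (le_trans (powR_vnorm_vadd_le _ _ q0)).
rewrite mulrA ler_wpM2l ?mulr_ge0 ?powR_ge0//.
rewrite -powR_tprod; last by move=> u; rewrite addr_ge0.
rewrite ge0_ler_powR ?nnegrE ?addr_ge0 ?vnorm_ge0 ?vnorm_le_tprod//.
by apply: tprod_ge0 => u; rewrite addr_ge0.
Qed.

(** One factor [2 ^ q] comes from separating centre and noise, the other from
    [(1 + v) ^ q <= 2 ^ q * (1 + v ^ q)], which brings in the moment of [mu]. *)
Lemma integral_vnorm_smooth_pdf_le (mu : probability Rd R) (q m : R) : (0 <= q)%R ->
  \int[mu]_x ((vnorm x `^ q)%:E) = m%:E ->
  \int[L]_y (((1 + vnorm y) `^ q)%:E * (smooth_pdf s mu y)%:E) <=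
  (2 `^ q * (2 `^ q * (1 + m)))%:E *
    (\int[leb]_t ((1 + `|t|) `^ q * normal_pdf 0 s t)%:E) ^+ d.
Proof.
move=> q0 mE; set J := (X in _ <= _ * X).
have J0 : 0 <= J.
  apply: expe_ge0; apply: integral_ge0 => t _.
  by rewrite lee_fin mulr_ge0 ?powR_ge0 ?normal_pdf_ge0.
have mpq : measurable_fun setT (fun y : Rd => ((1 + vnorm y) `^ q)%:E).
  by apply/measurable_EFinP; exact: measurable_powR_vnorm.
have -> : \int[L]_y (((1 + vnorm y) `^ q)%:E * (smooth_pdf s mu y)%:E) =
    \int[L]_y \int[mu]_x (((1 + vnorm y) `^ q)%:E * (gauss_pdf s x y)%:E).
  apply: eq_integral => y _; rewrite -(smooth_pdfE s0) ge0_integralZl//.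
  - by apply/measurable_EFinP; exact: measurable_gauss_pdf1.
  - by move=> x _; rewrite lee_fin gauss_pdf_ge0.
  - by rewrite lee_fin powR_ge0.
rewrite -(@fubini_tonelli _ _ _ _ _ mu L (fun u =>
    ((1 + vnorm u.2) `^ q)%:E * (gauss_pdf s u.1 u.2)%:E)); last 2 first.
- apply: emeasurable_funM; first exact: (measurableT_comp mpq).
  by apply/measurable_EFinP; exact: measurable_gauss_pdf.
- by move=> u; rewrite mule_ge0// lee_fin ?powR_ge0// gauss_pdf_ge0.
apply: (@le_trans _ _ (\int[mu]_x ((2 `^ q * (2 `^ q * (1 + vnorm x `^ q)))%:E * J))).
  apply: le_integral_pointwise => x /=.
    by apply: integral_ge0 => y _; rewrite mule_ge0// lee_fin ?powR_ge0// gauss_pdf_ge0.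
  apply: (le_trans (integral_vnorm_gauss_pdf_le x q0)).
  rewrite lee_wpmul2r// lee_fin ler_wpM2l ?powR_ge0//.
  by apply: powR_1D_le => //; exact: vnorm_ge0.
have mvq : measurable_fun setT (fun x : Rd => (vnorm x `^ q)%:E).
  apply/measurable_EFinP.
  exact: (measurableT_comp (measurable_powR q) measurable_vnorm).
have mvq1 : measurable_fun setT (fun x : Rd => (1 + vnorm x `^ q)%:E).
  by apply/measurable_EFinP/measurable_funD => //; exact/measurable_EFinP.
rewrite ge0_integralZr//; last 2 first.
- apply/measurable_EFinP/measurable_funM => //; apply/measurable_funM => //.
  exact/measurable_EFinP.
- by move=> x _; rewrite lee_fin !mulr_ge0 ?addr_ge0 ?powR_ge0.
rewrite lee_wpmul2r// le_eqVlt; apply/orP; left; apply/eqP.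
under eq_integral do rewrite mulrA EFinM.
rewrite ge0_integralZl ?lee_fin ?mulr_ge0 ?powR_ge0//; last first.
  by move=> x _; rewrite lee_fin addr_ge0 ?powR_ge0.
rewrite mulrA [RHS]EFinM; congr (_ * _).
under eq_integral do rewrite EFinD.
rewrite ge0_integralD//; last by move=> x _; rewrite lee_fin powR_ge0.
by rewrite integral_probability_cst mE.
Qed.

End expectation.

Section expected_wasserstein.
Local Open Scope ereal_scope.
Context {R : realType} (d : nat) (p q r s a : R).
Local Notation RM := (measurableTypeR R).
Local Notation Rd := (d.-tuple R).
Local Notation leb := (@lebesgue_measure R : {sigma_finite_measure set RM -> \bar R}).
Local Notation lint := (@prod_int R _ RM leb).
Variable L : {sigma_finite_measure set Rd -> \bar R}.
Hypothesis LE : forall f : Rd -> \bar R, measurable_fun setT f ->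
  (forall t, 0 <= f t) -> \int[L]_t f t = lint f.
Hypotheses (s0 : (0 < s)%R) (p1 : (1 <= p)%R) (q0 : (0 <= q)%R).
Hypotheses (r1 : (1 < r)%R) (r2 : (r <= 2)%R) (a0 : (0 <= a)%R).
Hypothesis aE : (a * (r - 1) * d%:R = q - p * r)%R.

(** [5 / 2] comes from the empirical mean bound, [2 ^ p] from the transport cost, and the power of
    the peak from bounding [g ^ r] by a multiple of [g]. *)
Let c1 := (5 / 2 * 2 `^ p * (normal_peak s ^+ d) `^ (r - 1))%R.
Let c2 := (2 `^ p / 2)%R.
Let J := (\int[leb]_t ((1 + `|t|) `^ q * normal_pdf 0 s t)%:E) ^+ d.
Let W := (\int[leb]_t ((1 + `|t|) `^ (- a))%:E) ^+ d.

Let c10 : (0 <= c1)%R. Proof. by rewrite !mulr_ge0 ?powR_ge0. Qed.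
Let c20 : (0 <= c2)%R. Proof. by rewrite divr_ge0 ?powR_ge0. Qed.

Let w (y : Rd) : R := tprod (fun t => ((1 + `|t|) `^ (- a))%R) y.

Let w_gt0 y : (0 < w y)%R.
Proof. by apply: prodr_gt0 => i _; rewrite powR_gt0// ltr_pwDl. Qed.

Let mw : measurable_fun setT w.
Proof. exact: (measurable_tprod (measurable_powR_norm (- a))). Qed.

Let tau (y : Rd) := ((1 + vnorm y) `^ (- p) * w y)%R.

(** The kernel is bounded, so [g ^ r = g ^ (r - 1) * g] is at most a constant times [g], whose mean
    is the smoothed density. *)
Let gauss_powR_integral_le (mu : probability Rd R) y :
  \int[mu]_x (gauss_pdf s x y `^ r)%:E <=
  ((normal_peak s ^+ d) `^ (r - 1) * smooth_pdf s mu y)%:E.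
Proof.
rewrite EFinM -(smooth_pdfE s0) -ge0_integralZl//; last 3 first.
- by apply/measurable_EFinP; exact: measurable_gauss_pdf1.
- by move=> x _; rewrite lee_fin gauss_pdf_ge0.
- by rewrite lee_fin powR_ge0.
apply: le_integral_pointwise => x; rewrite lee_fin ?powR_ge0//.
rewrite mulrC -mulr_powRB1 ?gauss_pdf_ge0 ?(lt_trans _ r1)//.
rewrite ler_wpM2l ?gauss_pdf_ge0// ge0_ler_powR ?nnegrE ?gauss_pdf_ge0 ?subr_ge0 ?(ltW r1)//.
  by rewrite exprn_ge0 ?normal_peak_ge0.
exact: gauss_pdf_le.
Qed.

Lemma expected_wasserstein_le dO (Omega : measurableType dO)
    (P : probability Omega R) (mu : probability Rd R)
    (X : nat -> {RV P >-> Rd}) (m : R) (N : nat) :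
  \int[mu]_x ((vnorm x) `^ q)%:E = m%:E -> iid_seq X mu -> (1 <= N)%N ->
  \int[P]_w (wasserstein_sigma p s (empirical N (fun k => X k w)) mu `^ p) <=
  (N%:R `^ (r^-1 - 1))%:E *
    (c1%:E * ((2 `^ q * (2 `^ q * (1 + m)))%:E * J) + c2%:E * W).
Proof.
move=> mE Xiid N1; set n := (N%:R `^ (r^-1 - 1))%R.
have n0 : (0 <= n)%R by exact: powR_ge0.
pose V (y : Rd) := (2 `^ p * (1 + vnorm y) `^ p)%R.
have V0 y : (0 <= V y)%R by rewrite mulr_ge0 ?powR_ge0.
have mV : measurable_fun setT V.
  by apply: measurable_funM => //; exact: measurable_powR_vnorm.
pose dev o y := (`|N%:R^-1 * (\sum_(k < N) gauss_pdf s (X k o) y) - smooth_pdf s mu y|)%R.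
have dev0 o y : (0 <= dev o y)%R by exact: normr_ge0.
have mdev : measurable_fun setT (fun u : Omega * Rd => dev u.1 u.2).
  apply: measurableT_comp => //; apply: measurable_funB.
    apply: measurable_funM => //; apply: measurable_sum => k.
    have mX : measurable_fun setT (fun u : Omega * Rd => (X k u.1, u.2) : Rd * Rd).
      apply: measurable_fun_pair => //.
      have mXk : measurable_fun setT (X k) by exact: measurable_funP.
      exact: (measurableT_comp mXk measurable_fst).
    exact: (measurableT_comp (measurable_gauss_pdf s) mX).
  exact: (measurableT_comp (measurable_smooth_pdf s0 mu)).
have mVdev : measurable_fun setT (fun u : Omega * Rd => (V u.2 * dev u.1 u.2)%:E).
  apply/measurable_EFinP/measurable_funM => //.
  exact: (measurableT_comp mV).
(* The distance is replaced by an upper bound that is jointly measurable in the sample and [y], so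
   that Tonelli applies. *)
apply: (@le_trans _ _ (\int[P]_o \int[L]_y (V y * dev o y)%:E)).
  apply: le_integral_pointwise => o; first exact: poweR_ge0.
  exact: (wasserstein_sigma_le LE).
rewrite (@fubini_tonelli _ _ _ _ _ P L (fun u => (V u.2 * dev u.1 u.2)%:E))//; last first.
  by move=> u; rewrite lee_fin mulr_ge0.
pose f := smooth_pdf s mu.
have f0 y : (0 <= f y)%R by exact: smooth_pdf_ge0.
have mf : measurable_fun setT f by exact: measurable_smooth_pdf.
apply: (@le_trans _ _ (\int[L]_y (n%:E *
    (c1%:E * (((1 + vnorm y) `^ q)%:E * (f y)%:E) + c2%:E * (w y)%:E)))).
  apply: le_integral_pointwise => y /=.
    by apply: integral_ge0 => o _; rewrite lee_fin mulr_ge0.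
  have tau0 : (0 < tau y)%R by rewrite mulr_gt0// powR_gt0// ltr_pwDl// vnorm_ge0.
  under eq_integral do rewrite EFinM.
  rewrite ge0_integralZl//; last 3 first.
  - have mo : measurable_fun setT (fun o : Omega => (o, y)) by exact: measurable_fun_pair.
    by apply/measurable_EFinP; exact: (measurableT_comp mdev mo).
  - by move=> o _; rewrite lee_fin.
  - by rewrite lee_fin.
  have [law _] := Xiid.
  (* Used at each [y] separately, which is why the level [tau y] may vary with [y]. *)
  have := @L1_empirical_mean _ _ _ _ R P mu X law
    (fun i j A B => iid_seq_pairwise Xiid) (gauss_pdf s ^~ y) (f y) r (tau y) N
    (measurable_gauss_pdf1 s y) (gauss_pdf_ge0 s ^~ y) (smooth_pdfE s0 mu y) r1 r2 tau0 N1.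
  rewrite -/n => L1.
  have V0' : 0 <= (V y)%:E by rewrite lee_fin.
  apply: (le_trans (lee_wpmul2l V0' L1)).
  rewrite muleCA; apply: lee_wpmul2l; first by rewrite lee_fin.
  pose K := ((normal_peak s ^+ d) `^ (r - 1))%R.
  have t0 : (0 <= 5 / 2 * tau y `^ (1 - r))%R by rewrite mulr_ge0 ?powR_ge0.
  have G0 : 0 <= \int[mu]_x (gauss_pdf s x y `^ r)%:E.
    by apply: integral_ge0 => x _; rewrite lee_fin powR_ge0.
  have t0' : 0 <= (5 / 2 * tau y `^ (1 - r))%:E by rewrite lee_fin.
  have h1 := lee_wpmul2l t0' (gauss_powR_integral_le mu y).
  apply: (le_trans (lee_wpmul2l V0' (leeD h1 (lexx (tau y / 2)%:E)))).
  rewrite -?EFinM -?EFinD -?EFinM -?EFinD -?EFinM lee_fin.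
  have := weight_bound y r1 aE a0; rewrite -/(w y) -/(tau y) => wb.
  have Vtau : (V y * tau y = 2 `^ p * w y)%R.
    have vp : ((1 + vnorm y) `^ p != 0)%R.
      by rewrite gt_eqF// powR_gt0// ltr_pwDl// vnorm_ge0.
    by rewrite /V /tau powRN; field.
  have K0 : (0 <= K)%R by exact: powR_ge0.
  rewrite mulrDr /c2 /c1 -/K -/(f y); apply: lerD.
    rewrite /V.
    have -> : (2 `^ p * (1 + vnorm y) `^ p * (5 / 2 * tau y `^ (1 - r) * (K * f y)) =
      5 / 2 * 2 `^ p * K * f y * ((1 + vnorm y) `^ p * tau y `^ (1 - r)))%R by ring.
    have -> : (5 / 2 * 2 `^ p * K * ((1 + vnorm y) `^ q * f y) =
      5 / 2 * 2 `^ p * K * f y * (1 + vnorm y) `^ q)%R by ring.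
    by rewrite ler_wpM2l// !mulr_ge0 ?powR_ge0.
  rewrite le_eqVlt; apply/orP; left; apply/eqP.
  by rewrite mulrA Vtau; field.
have mqf : measurable_fun setT (fun y : Rd => ((1 + vnorm y) `^ q)%:E * (f y)%:E).
  apply: emeasurable_funM; apply/measurable_EFinP => //.
  exact: measurable_powR_vnorm.
have qf0 y : 0 <= ((1 + vnorm y) `^ q)%:E * (f y)%:E.
  by rewrite mule_ge0// lee_fin ?powR_ge0.
have mEw : measurable_fun setT (EFin \o w) by exact/measurable_EFinP.
have Ew0 y : 0 <= (w y)%:E by rewrite lee_fin ltW.
have m1 : measurable_fun setT (fun y : Rd => c1%:E * (((1 + vnorm y) `^ q)%:E * (f y)%:E)).
  exact: emeasurable_funM.
have m2 : measurable_fun setT (fun y : Rd => c2%:E * (w y)%:E).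
  exact: emeasurable_funM.
have z1 y : 0 <= c1%:E * (((1 + vnorm y) `^ q)%:E * (f y)%:E).
  by rewrite mule_ge0// lee_fin.
have z2 y : 0 <= c2%:E * (w y)%:E by rewrite mule_ge0// lee_fin.
rewrite ge0_integralZl//; last 2 first.
- exact: emeasurable_funD.
- by move=> y _; rewrite adde_ge0.
apply: lee_wpmul2l; first by rewrite lee_fin.
rewrite ge0_integralD// ge0_integralZl// ge0_integralZl//.
apply: leeD; apply: lee_wpmul2l; rewrite ?lee_fin//.
  exact: (integral_vnorm_smooth_pdf_le LE s0 q0 mE).
rewrite LE// le_eqVlt; apply/orP; left; apply/eqP.
apply: prod_int_tprod.
- exact: measurable_powR_norm.
- by move=> t; exact: powR_ge0.
Qed.

End expected_wasserstein.

(** * Choice of the exponents and of the constant *)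

Theorem theorem2p5 (R : realType) (d : nat) (p q sigma beta Mq : R) :
  (1 <= d)%N -> 1 <= p -> p < q -> 0 < sigma ->
  1 < beta -> beta < (q + d%:R) / (p + d%:R) ->
  exists C : R, 0 <= C /\
    forall (dO : measure_display) (Omega : measurableType dO)
      (P : probability Omega R) (mu : probability (d.-tuple R) R)
      (X : nat -> {RV P >-> d.-tuple R}),
      moment q mu = Mq%:E ->
      iid_seq X mu ->
      forall N : nat, (1 <= N)%N ->
      (\int[P]_w (wasserstein_sigma p sigma (empirical N (fun k => X k w)) mu
                  `^ p)
         <= (C / (N%:R `^ Num.min ((beta - 1) / beta) (1 / 2)))%:E)%E.
Proof.
move=> d1 p1 pq s0 b1 bb.
have d0 : 0 < d%:R :> R by rewrite ltr0n.
have q0 : 0 < q by apply: lt_trans pq; apply: lt_le_trans p1.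
pose r := Num.min beta 2.
have r1 : 1 < r by rewrite lt_min b1 ltr1n.
have r2 : r <= 2 by rewrite ge_min lexx orbT.
have rb : r <= beta by rewrite ge_min lexx.
have pd0 : 0 < p + d%:R by rewrite addr_gt0// (lt_le_trans _ p1).
have hr : r * (p + d%:R) < q + d%:R.
  by apply: le_lt_trans (_ : beta * (p + d%:R) < _); rewrite ?ler_pM2r -?ltr_pdivlMr.
have r10 : 0 < r - 1 by rewrite subr_gt0.
pose a := (q - p * r) / ((r - 1) * d%:R).
have aE : a * (r - 1) * d%:R = q - p * r by rewrite -mulrA divfK// gt_eqF// mulr_gt0.
have a1 : 1 < a by rewrite ltr_pdivlMr ?mulr_gt0//; lra.
have a0 : 0 <= a by rewrite ltW// (lt_trans _ a1).
have [L LE] := lebesgue_tuple_measure (R := R) d.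
have fin_int (h : R -> R) : (forall t, 0 <= h t) ->
    (\int[@lebesgue_measure R]_t (h t)%:E < +oo)%E ->
    exists2 j : R, 0 <= j & (\int[@lebesgue_measure R]_t (h t)%:E = j%:E)%E.
  move=> h0 hoo; have i0 : (0 <= \int[@lebesgue_measure R]_t (h t)%:E)%E.
    by apply: integral_ge0 => t _; rewrite lee_fin.
  exists (fine (\int[@lebesgue_measure R]_t (h t)%:E)%E); first exact: fine_ge0.
  by rewrite fineK// ge0_fin_numE.
have [j j0 jE] := fin_int (fun t => (1 + `|t|) `^ q * normal_pdf 0 sigma t)
  (fun t => mulr_ge0 (powR_ge0 _ _) (normal_pdf_ge0 _ _ _))
  (integral_powR_norm_normal_lty (ltW q0) s0).
have [k k0 kE] := fin_int (fun t => (1 + `|t|) `^ (- a))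
  (fun t => powR_ge0 _ _) (integral_powR_norm_lty a1).
(* [Mq ^ q] is the integral of [|x| ^ q], because [moment] takes the [q]-th root. Every ingredient
   is fixed before the probability space, [mu] and the sample appear. *)
pose C := 5 / 2 * 2 `^ p * (normal_peak sigma ^+ d) `^ (r - 1) *
  (2 `^ q * (2 `^ q * (1 + Mq `^ q)) * j ^+ d) + 2 `^ p / 2 * k ^+ d.
exists C; split.
  by rewrite addr_ge0// !mulr_ge0 ?powR_ge0 ?exprn_ge0// addr_ge0// powR_ge0.
move=> dO Omega P mu X momE Xiid N N1.
have mE : (\int[mu]_x ((vnorm x) `^ q)%:E = (Mq `^ q)%:E)%E.
  have : (moment q mu `^ q = Mq%:E `^ q)%E by rewrite momE.
  rewrite /moment -poweRrM mulVf ?gt_eqF// poweRe1 ?poweR_EFin//.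
  by apply: integral_ge0 => x _; rewrite lee_fin powR_ge0.
apply: (le_trans (expected_wasserstein_le LE s0 p1 (ltW q0) r1 r2 a0 aE mE Xiid N1)).
rewrite jE kE -!EFin_expe lee_fin -/C.
(* The map [t |-> 1 - t^-1] is increasing and equals [1 / 2] at [2], so the minimum of the two rates
   is its value at [r]. *)
have -> : Num.min ((beta - 1) / beta) (1 / 2) = - (r^-1 - 1).
  have b0 : 0 < beta by rewrite (lt_trans _ b1).
  have E : (beta - 1) / beta = 1 - beta^-1 by field; rewrite gt_eqF.
  rewrite opprB E /r; case: (leP beta 2) => b2.
    rewrite min_l//; have : 2^-1 <= beta^-1 by rewrite lef_pV2// posrE.
    by lra.
  rewrite min_r; first by field.
  have : beta^-1 <= 2^-1 by rewrite lef_pV2 ?posrE// ltW.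
  by lra.
by rewrite powRN invrK mulrC.
Qed.
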